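(* Let $G$ be a simple graph on $n\ge 2$ vertices. Then $$\Big\lceil\frac{|E(G)|}{2n-2}\Big\rceil \le \theta(G\times K_2)\le \Big\lceil\frac{n}{4}\Big\rceil.$$
   Context: The thickness $\theta(G)$ of a graph $G$ is the minimum number of planar subgraphs whose union is $G$. The Kronecker product $G\times H$ of graphs $G$ and $H$ is the graph with vertex set $V(G)\times V(H)$ in which $(g,h)$ and $(g',h')$ are adjacent if and only if $gg'\in E(G)$ and $hh'\in E(H)$. *)

(* Defs.v *)
From HB Require Import structures.
From mathcomp Require Import all_boot.
From Stdlib Require Import Reals.

Set Implicit Arguments.
Unset Strict Implicit.
Unset Printing Implicit Defensive.

(* A finite graph (V, r): the edges are the unordered pairs {u,v} with r u v.
   planar r : there is an embedding in R^2 = R*R: injective vertex positions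
   (px,py), and for each edge a continuous simple arc (cx u v, cy u v) defined on
   [0,1] (extended continuously to all of R) joining the two endpoints, whose
   interior avoids all vertices, and such that interiors of arcs of distinct
   edges are disjoint. *)
Local Open Scope R_scope.
Definition planar (V : finType) (r : rel V) : Prop :=
  exists (px py : V -> R) (cx cy : V -> V -> R -> R),
    (forall u v, px u = px v -> py u = py v -> u = v) /\
    (forall u v, r u v ->
        continuity (cx u v) /\ continuity (cy u v) /\
        cx u v 0 = px u /\ cy u v 0 = py u /\
        cx u v 1 = px v /\ cy u v 1 = py v /\
        (forall s t, 0 <= s <= 1 -> 0 <= t <= 1 ->
           cx u v s = cx u v t -> cy u v s = cy u v t -> s = t) /\
        (forall t w, 0 < t < 1 -> ~ (cx u v t = px w /\ cy u v t = py w))) /\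
    (forall u v u' v', r u v -> r u' v' ->
        ~ ((u = u' /\ v = v') \/ (u = v' /\ v = u')) ->
        forall s t, 0 < s < 1 -> 0 < t < 1 ->
          ~ (cx u v s = cx u' v' t /\ cy u v s = cy u' v' t)).
Local Close Scope R_scope.

Definition kron (T U : finType) (e : rel T) (f : rel U) : rel (T * U) :=
  fun p q => e p.1 q.1 && f p.2 q.2.

Definition K2 : rel bool := fun a b => a != b.

Definition planar_decomposition (V : finType) (r : rel V) (k : nat)
    (H : 'I_k -> rel V) : Prop :=
  (forall i x y, H i x y -> r x y) /\
  (forall i, planar (H i)) /\
  (forall x y, r x y -> exists i, H i x y).

Definition thickness (V : finType) (r : rel V) (t : nat) : Prop :=
  (exists H : 'I_t -> rel V, planar_decomposition r H) /\
  (forall k (H : 'I_k -> rel V), planar_decomposition r H -> t <= k).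

Definition nedges (V : finType) (r : rel V) : nat :=
  #|[set p : V * V | r p.1 p.2]| %/ 2.

(* Main.v *)
Require Import Defs.
From Stdlib Require Import Reals Lra Psatz Classical ClassicalEpsilon.
From Coquelicot Require Import Coquelicot.
From HB Require Import structures.
From mathcomp Require Import all_boot.
From mathcomp Require Import zify.

Set Implicit Arguments.
Unset Strict Implicit.
Unset Printing Implicit Defensive.

(** Lower bound.  A planar bipartite graph with [N >= 3] vertices has at most
    [2 N - 4] edges, and the layers of a decomposition of [G x K2] are bipartite
    with [N = 2 n].  Vertices of degree at most two can be deleted, so assume
    there are none.  Replace the arcs by polygonal ones which are radial near
    the vertices.  For an even subgraph [z] and a point [p] off the drawing let
    [winding z p] be the parity of the number of times [z] crosses the vertical
    ray above [p]; as a functional of [z] it changes only when [p] crosses an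
    edge [e], and then by the coefficient of [e].  The finitely many functionals
    seen next to the edges replace the faces, so that neither a rotation system nor the Jordan
    curve theorem is needed: turning around a vertex shows that each functional
    is seen at four edges at least, hence there are at most [E / 2] of them,
    and they separate the points of the cycle space up to a constant, so that
    there are at least [E - N + 2].

    Upper bound.  Split the vertices of [K_n] into blocks of four.  The layer of
    a block [k] contains the cube [K_4 x K_2] on this block, drawn as two nested
    squares.  Every other vertex is put on a diagonal of one of the four
    trapezoids between the squares and joined to two opposite corners of it.
    Which corners is decided by residues modulo four, in such a way that an edge
    between two blocks belongs to the layer of one of them. *)

Local Open Scope R_scope.

(** * Crossing parity of segments *)

Definition pt := (R * R)%type.

Definition leRb (x y : R) : bool := Rle_dec x y.
Definition ltRb (x y : R) : bool := Rlt_dec x y.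

Definition det (a b p : pt) : R :=
  (b.1 - a.1) * (p.2 - a.2) - (b.2 - a.2) * (p.1 - a.1).

Definition lerp (a b : pt) (t : R) : pt :=
  (a.1 + t * (b.1 - a.1), a.2 + t * (b.2 - a.2)).

Definition on_seg (a b x : pt) : Prop := exists2 t, 0 <= t <= 1 & x = lerp a b t.

(* Does [ab] cross the upward ray from [p], resp. [pq] the downward ray from [a]?
   Points on a common vertical are compared as if [p] and [q] were moved slightly
   to the right; with this convention the parities are right in all positions. *)
Definition ray_up (a b p : pt) : bool :=
  (leRb a.1 p.1 (+) leRb b.1 p.1) &&
  (if leRb a.1 p.1 then ltRb (det a b p) 0 else ltRb 0 (det a b p)).

Definition ray_down (p q a : pt) : bool :=
  (leRb a.1 p.1 (+) leRb a.1 q.1) &&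
  (if leRb a.1 p.1 then ltRb (det p q a) 0 else ltRb 0 (det p q a)).

(** Cramer's rule: unequal determinants mean that the lines are not parallel. The parameters of
    their common point are quotients of determinants, and the sign conditions place them in
    [0,1]. *)
Lemma det_meet a b p q :
  det a b p <> det a b q ->
  det a b p * det a b q <= 0 -> det p q a * det p q b <= 0 ->
  exists2 x, on_seg a b x & on_seg p q x.
Proof.
move=> nAB AB CD.
have E : det a b q - det a b p = det p q a - det p q b by rewrite /det; ring.
have nCD : det p q a <> det p q b by lra.
have r01 : forall u v : R, u <> v -> u * v <= 0 -> 0 <= u / (u - v) <= 1.
  move=> u v nuv uv.
  have i2 : 0 < (u - v) * (u - v) by nra.
  have -> : u / (u - v) = (u * (u - v)) / ((u - v) * (u - v)) by field; lra.
  split; first by apply: Rmult_le_pos; [nra | apply: Rlt_le; apply: Rinv_0_lt_compat].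
  apply: (Rmult_le_reg_r ((u - v) * (u - v))) => //.
  rewrite /Rdiv Rmult_assoc Rinv_l; nra.
exists (lerp p q (det a b p / (det a b p - det a b q))); last first.
  by eexists; [exact: (r01 _ _ nAB) | ].
exists (det p q a / (det p q a - det p q b)); first exact: r01.
have n1 : det a b p - det a b q <> 0 by lra.
have n2 : det p q a - det p q b <> 0 by lra.
congr pair; field_simplify_eq; try (by split); rewrite /det; ring.
Qed.

(* The boundary of the parallelogram swept by [ab] as [p] moves to [q] crosses the
   ray above [p] an even number of times, unless [p] lies in the parallelogram. *)
Lemma ray_meet a b p q :
  ray_up a b p (+) ray_up a b q <> ray_down p q a (+) ray_down p q b ->
  exists2 x, on_seg a b x & on_seg p q x.
Proof.
(* These two linear identities are all that the case analysis keeps of [det]; the rest is sign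
   arithmetic. *)
have E1 : det a b q - det a b p = det p q a - det p q b by rewrite /det; ring.
have E2 : det a b q * p.1 - det a b p * q.1 = det p q a * b.1 - det p q b * a.1.
  by rewrite /det; ring.
rewrite /ray_up /ray_down => H; apply: det_meet; move: H; move: E1 E2.
all: move: (det a b p) (det a b q) (det p q a) (det p q b) => A B C D.
all: rewrite /leRb /ltRb; case: a => a1 a2; case: b => b1 b2; case: p => p1 p2; case: q => q1 q2 /=.
all: case: (Rle_dec a1 p1) => ap; case: (Rle_dec a1 q1) => aq; case: (Rle_dec b1 p1) => bp; case: (Rle_dec b1 q1) => bq //=.
all: repeat (case: Rlt_dec => ? /=) => //.
all: move=> E1 E2 _; try lra; try nra.
all: repeat match goal with H : ~ (_ <= _) |- _ => apply Rnot_le_lt in H | H : ~ (_ < _) |- _ => apply Rnot_lt_le in H end.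
all: match goal with |- ?x * ?y <= 0 =>
  apply: Rnot_lt_le => h; case: (Rlt_le_dec x 0) => hx;
  [have hy : y < 0 by nra | (have hy : 0 < y by nra); (have hx' : 0 < x by nra)]; clear h; try lra; try nra end.
Qed.

(** A partial converse of [ray_meet]: the four determinants are the multiples of the cross product
    [K] of the directions by [- t], [1 - t], [s] and [s - 1], so their signs are known. *)
Lemma ray_cross a b p q s t :
  0 < s < 1 -> 0 < t < 1 -> lerp a b s = lerp p q t ->
  det a b p <> det a b q ->
  ray_up a b p (+) ray_up a b q (+) (ray_down p q a (+) ray_down p q b).
Proof.
move=> s01 t01 [E1 E2] nd.
set K := det a b q - det a b p; have K0 : K <> 0 by rewrite /K; lra.
have EK : K = (b.1 - a.1) * (q.2 - p.2) - (b.2 - a.2) * (q.1 - p.1).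
  by rewrite /K /det; ring.
have p1 : p.1 - a.1 = s * (b.1 - a.1) - t * (q.1 - p.1) by lra.
have p2 : p.2 - a.2 = s * (b.2 - a.2) - t * (q.2 - p.2) by lra.
have q1 : q.1 - a.1 = s * (b.1 - a.1) + (1 - t) * (q.1 - p.1) by lra.
have q2 : q.2 - a.2 = s * (b.2 - a.2) + (1 - t) * (q.2 - p.2) by lra.
have a1 : a.1 - p.1 = - s * (b.1 - a.1) + t * (q.1 - p.1) by lra.
have a2 : a.2 - p.2 = - s * (b.2 - a.2) + t * (q.2 - p.2) by lra.
have b1 : b.1 - p.1 = (1 - s) * (b.1 - a.1) + t * (q.1 - p.1) by lra.
have b2 : b.2 - p.2 = (1 - s) * (b.2 - a.2) + t * (q.2 - p.2) by lra.
have EA : det a b p = - t * K by rewrite /det p1 p2 EK; ring.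
have EB : det a b q = (1 - t) * K by rewrite /det q1 q2 EK; ring.
have EC : det p q a = s * K by rewrite /det a1 a2 EK; ring.
have ED : det p q b = - (1 - s) * K by rewrite /det b1 b2 EK; ring.
rewrite /ray_up /ray_down EA EB EC ED.
move: K K0 EK {nd E2 EA EB EC ED p1 p2 q1 q2 a1 a2 b1 b2} => K K0.
rewrite /leRb /ltRb; case: a E1 => a1 a2; case: b => b1 b2; case: p => p1 p2; case: q => q1 q2 /= E1 EK.
have cmb : (1 - s) * a1 + s * b1 = (1 - t) * p1 + t * q1 by lra.
have cases : (exists2 k, 0 < k & K = k) \/ (exists2 k, 0 < k & K = - k).
  by case: (Rlt_le_dec K 0) => Ks; [right; exists (- K)|left; exists K]; lra.
case: (Rle_dec a1 p1) => ap; case: (Rle_dec a1 q1) => aq; case: (Rle_dec b1 p1) => bp; case: (Rle_dec b1 q1) => bq //=.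
all: repeat match goal with H : ~ (_ <= _) |- _ => apply Rnot_le_lt in H end.
(* Here no abscissa of [a], [b] exceeds one of [p], [q]; a common interior point makes both segments
   vertical, and [K] would vanish. *)
1: { exfalso; have e1 : a1 = b1 by nra. have e2 : p1 = q1 by nra.
     by apply: K0; rewrite EK e1 e2; ring. }
all: clear EK; try (exfalso; nra).
13: by exfalso; case: (Rle_lt_dec a1 b1) => ?; case: (Rle_lt_dec p1 q1) => ?; nra.
all: case: cases => -[k k0 ->].
all: have h1 : 0 < t * k by nra.
all: have h2 : 0 < (1 - t) * k by nra.
all: have h3 : 0 < s * k by nra.
all: have h4 : 0 < (1 - s) * k by nra.
all: repeat (case: Rlt_dec => ? /=) => //.
all: repeat match goal with H : ~ (_ < _) |- _ => apply Rnot_lt_le in H end.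
all: exfalso; lra.
Qed.

(** * Compactness and connectedness arguments *)

Definition near (eps : R) (x y : pt) : Prop :=
  Rabs (x.1 - y.1) < eps /\ Rabs (x.2 - y.2) < eps.

(** Disjoint compact arcs have positive distance, by compactness of the rectangle of parameters. *)
Lemma separated (ax ay bx by_ : R -> R) (s0 s1 t0 t1 : R) :
  (forall s, continuity_pt ax s) -> (forall s, continuity_pt ay s) ->
  (forall s, continuity_pt bx s) -> (forall s, continuity_pt by_ s) ->
  (forall s t, s0 <= s <= s1 -> t0 <= t <= t1 -> ax s = bx t -> ay s = by_ t -> False) ->
  exists2 d, 0 < d & forall s t, s0 <= s <= s1 -> t0 <= t <= t1 ->
    ~ near d (ax s, ay s) (bx t, by_ t).
Proof.
move=> cax cay cbx cby dis.
have ctn (f : R -> R) : (forall s, continuity_pt f s) -> forall s eps, 0 < eps ->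
    exists2 d, 0 < d & forall s', Rabs (s' - s) < d -> Rabs (f s' - f s) < eps.
  move=> cf s eps e0; have [d [d0 Hd]] := cf s eps e0.
  exists d; first exact: d0.
  move=> s' ss'; case: (Req_dec s s') => [->|ne].
    by rewrite Rminus_diag Rabs_R0.
  by apply: (Hd s'); split; [split | exact: ss'].
have loc : forall s t, exists d : posreal, s0 <= s <= s1 -> t0 <= t <= t1 ->
   forall s' t', Rabs (s' - s) < d -> Rabs (t' - t) < d -> ~ near d (ax s', ay s') (bx t', by_ t').
  move=> s t.
  set m := Rmax (Rabs (ax s - bx t)) (Rabs (ay s - by_ t)).
  case: (Rle_lt_dec m 0) => [m0|m0].
    exists (mkposreal 1 Rlt_0_1) => hs ht; exfalso; apply: (dis s t) => //.
      have := Rmax_l (Rabs (ax s - bx t)) (Rabs (ay s - by_ t)); rewrite -/m => h.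
      have := Rabs_pos (ax s - bx t) => h'.
      have : Rabs (ax s - bx t) = 0 by lra.
      by move/Rcomplements.Rabs_eq_0; lra.
    have := Rmax_r (Rabs (ax s - bx t)) (Rabs (ay s - by_ t)); rewrite -/m => h.
    have := Rabs_pos (ay s - by_ t) => h'.
    have : Rabs (ay s - by_ t) = 0 by lra.
    by move/Rcomplements.Rabs_eq_0; lra.
  (* Two displacements and one gap, each at most [m / 4], add up to less than the max-norm distance
     [m] at the centre. *)
  have m4 : 0 < m / 4 by lra.
  have [d1 d10 h1] := ctn _ cax s _ m4.
  have [d2 d20 h2] := ctn _ cay s _ m4.
  have [d3 d30 h3] := ctn _ cbx t _ m4.
  have [d4 d40 h4] := ctn _ cby t _ m4.
  set d := Rmin (m / 4) (Rmin (Rmin d1 d2) (Rmin d3 d4)).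
  have d0 : 0 < d by do !apply: Rmin_pos.
  exists (mkposreal d d0) => _ _ s' t' /= hs ht [] /=.
  have [l1 [l2 [l3 [l4 l5]]]] : d <= m/4 /\ d <= d1 /\ d <= d2 /\ d <= d3 /\ d <= d4.
    have := Rmin_l (m / 4) (Rmin (Rmin d1 d2) (Rmin d3 d4)).
    have := Rmin_r (m / 4) (Rmin (Rmin d1 d2) (Rmin d3 d4)).
    have := Rmin_l (Rmin d1 d2) (Rmin d3 d4); have := Rmin_r (Rmin d1 d2) (Rmin d3 d4).
    have := Rmin_l d1 d2; have := Rmin_r d1 d2.
    have := Rmin_l d3 d4; have := Rmin_r d3 d4.
    by rewrite /d; lra.
  have {}h1 := h1 s' ltac:(lra).
  have {}h2 := h2 s' ltac:(lra).
  have {}h3 := h3 t' ltac:(lra).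
  have {}h4 := h4 t' ltac:(lra).
  move=> n1 n2.
  have : m < m; last by lra.
  rewrite {1}/m; apply: Rmax_lub_lt.
    have : Rabs (ax s - bx t) <= Rabs (ax s' - ax s) + Rabs (ax s' - bx t') + Rabs (bx t' - bx t); last by lra.
    by unfold Rabs; repeat case: Rcase_abs => ?; lra.
  have : Rabs (ay s - by_ t) <= Rabs (ay s' - ay s) + Rabs (ay s' - by_ t') + Rabs (by_ t' - by_ t); last by lra.
  by unfold Rabs; repeat case: Rcase_abs => ?; lra.
pose F s t : posreal := proj1_sig (constructive_indefinite_description _ (loc s t)).
have HF s t := proj2_sig (constructive_indefinite_description _ (loc s t)).
have [d Hd] := compactness_value_2d s0 s1 t0 t1 F.
exists d; first exact: cond_pos.
(* Compactness yields the nearby centre only under a double negation, which is harmless for a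
   negative goal. *)
move=> s t hs ht nr; apply: (Hd s t hs ht) => -[s' [t' [hs' [ht' [h1 [h2 h3]]]]]].
apply: (HF s' t' hs' ht' s t h1 h2).
by case: nr => n1 n2; split; rewrite -/(F s' t'); lra.
Qed.

Lemma seg_open a b x : ~ on_seg a b x ->
  exists2 d, 0 < d & forall y, near d x y -> ~ on_seg a b y.
Proof.
move=> nx.
have cl : forall u v s, continuity_pt (fun t => u + t * (v - u)) s by move=> u v s; reg.
have cc : forall u s, continuity_pt (fun _ : R => u) s by move=> u s; reg.
have [s t hs ht /= e1 e2|d d0 Hd] := separated (s0:=0) (s1:=1) (t0:=0) (t1:=1) (cl a.1 b.1) (cl a.2 b.2) (cc x.1) (cc x.2).
  by apply: nx; exists s => //; rewrite /lerp e1 e2; case: (x).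
exists d => // y ny [t ht ey]; apply: (Hd t 0) => //; first by lra.
move: ny; rewrite ey /near /=; case=> n1 n2.
by split; rewrite Rabs_minus_sym.
Qed.

(** Connectedness of an interval: the supremum of the parameters up to which [P] keeps its first
    value must be [b]. *)
Lemma locally_constant_eq (P : R -> bool) (a b : R) : a <= b ->
  (forall t, a <= t <= b ->
     exists2 d, 0 < d & forall t', a <= t' <= b -> Rabs (t' - t) < d -> P t' = P t) ->
  P a = P b.
Proof.
move=> ab lc.
pose S t := a <= t <= b /\ forall t', a <= t' <= t -> P t' = P a.
have Sa : S a by split; [lra | move=> t' h; have -> : t' = a by lra].
have [m [ub lub]] : {m | is_lub S m}.
  by apply: completeness; [exists b => t []; lra | exists a].
have am : a <= m by exact: ub.
have mb : m <= b by apply: lub => t []; lra.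
have [d d0 Hd] := lc m (conj am mb).
have [t [St tm]] : exists t, S t /\ m - d < t.
  apply: NNPP => h.
  have : m <= m - d; last by lra.
  by apply: lub => t St; apply: Rnot_lt_le => tm; apply: h; exists t.
have tm' := ub t St; case: St => St1 St2.
have Pm : P m = P a.
  rewrite -(Hd t) //; first by apply: St2; lra.
  by apply: Rabs_def1; lra.
have ext t' : a <= t' <= b -> t' < m + d -> P t' = P a.
  move=> h1 h2; case: (Rle_lt_dec t' t) => h3; first by apply: St2; lra.
  by rewrite Hd //; apply: Rabs_def1; lra.
case: (Req_dec m b) => [<- //|mb'].
have : S (Rmin b (m + d / 2)).
  split; first by unfold Rmin; case: Rle_dec; lra.
  move=> t' h; apply: ext; move: h; unfold Rmin; case: Rle_dec; lra.
by move/ub; unfold Rmin; case: Rle_dec; lra.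
Qed.

Local Close Scope R_scope.

(** * Cycle spaces of bipartite graphs *)

(** Sets are vectors over the field with two elements: [symdiff] is their sum, and [xsum] pairs a
    set with a function. *)
Definition xsum (I : finType) (z : {set I}) (F : I -> bool) : bool :=
  \big[addb/false]_i ((i \in z) && F i).

Definition symdiff (I : finType) (z z' : {set I}) : {set I} :=
  [set i | (i \in z) (+) (i \in z')].

Lemma xsum_symdiff (I : finType) (z z' : {set I}) F :
  xsum (symdiff z z') F = xsum z F (+) xsum z' F.
Proof.
by rewrite /xsum -big_split; apply: eq_bigr => i _; rewrite inE /= andb_addl.
Qed.

Lemma xsum_addb (I : finType) (z : {set I}) F G :
  xsum z (fun i => F i (+) G i) = xsum z F (+) xsum z G.
Proof. by rewrite /xsum -big_split; apply: eq_bigr => i _; rewrite /= andb_addr. Qed.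

Lemma eq_xsum (I : finType) (z : {set I}) F G :
  {in z, F =1 G} -> xsum z F = xsum z G.
Proof.
by move=> FG; apply: eq_bigr => i _; case: (boolP (i \in z)) => //= /FG ->.
Qed.

Section Bipartite.
Variables A B : finType.
Implicit Types (E z F : {set A * B}) (S : {set A + B}) (e f : A * B).

Definition end_of e (b : bool) : A + B := if b then inr e.2 else inl e.1.
Definition inc e (v : A + B) : bool := (v == end_of e false) (+) (v == end_of e true).

Definition parity z v := xsum z (inc^~ v).
Definition cycles E : {set {set A * B}} :=
  [set z : {set A * B} | (z \subset E) && [forall v, ~~ parity z v]].
Definition spans S E := forall e, e \in E -> forall b, end_of e b \in S.

Lemma cyclesP E z :
  reflect (z \subset E /\ forall v, parity z v = false) (z \in cycles E).
Proof.
rewrite inE; apply: (iffP andP) => -[zE zp]; split=> //.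
  by move=> v; apply/negbTE/(forallP zp).
by apply/forallP => v; rewrite zp.
Qed.

Lemma cycles_symdiff E z z' :
  z \in cycles E -> z' \in cycles E -> symdiff z z' \in cycles E.
Proof.
move=> /cyclesP[zE zp] /cyclesP[zE' zp']; apply/cyclesP; split.
  apply/subsetP => e; rewrite inE.
  by case: (boolP (e \in z)) => [/(subsetP zE)|_ /=] // /(subsetP zE').
by move=> v; rewrite /parity xsum_symdiff -/(parity z v) zp -/(parity z' v) zp'.
Qed.

(** The coboundary of [G] summed over [z] is [G] summed over the boundary of [z]; on a cycle both
    vanish. *)
Lemma xsum_inc z (G : A + B -> bool) :
  xsum z (fun e => G (end_of e false) (+) G (end_of e true)) =
  \big[addb/false]_v (G v && parity z v).
Proof.
rewrite /parity /xsum.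
under [RHS]eq_bigr => v _ do rewrite big_distrr /=.
rewrite exchange_big /=; apply: eq_bigr => e _.
have -> : \big[addb/false]_v (G v && ((e \in z) && inc e v)) =
  (e \in z) && \big[addb/false]_v (G v && inc e v).
  by rewrite big_distrr /=; apply: eq_bigr => v _; rewrite andbCA.
congr andb.
under eq_bigr => v _ do rewrite /inc andb_addr.
rewrite big_split /=; congr addb.
  rewrite (bigD1 (end_of e false)) //= eqxx andbT big1 ?addbF // => v /negbTE ->.
  by rewrite andbF.
rewrite (bigD1 (end_of e true)) //= eqxx andbT big1 ?addbF // => v /negbTE ->.
by rewrite andbF.
Qed.

(** Every edge has two ends, so all parities add up to zero and the last one is determined by the
    others. *)
Lemma parity_last z S v0 : v0 \in S -> spans S z ->
  (forall v, v \in S :\ v0 -> parity z v = false) -> forall v, parity z v = false.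
Proof.
move=> v0S zS par0.
have out v : v \notin S -> parity z v = false.
  move=> vS; rewrite /parity /xsum big1 // => e _.
  case: (boolP (e \in z)) => //= ez; rewrite /inc.
  have ne b : (v == end_of e b) = false.
    by apply: contraNF vS => /eqP ->; apply: zS.
  by rewrite !ne.
have other v : v != v0 -> parity z v = false.
  by move=> vv0; case: (boolP (v \in S)) => [vS|/out //]; apply: par0; rewrite !inE vv0.
move=> v; have [->|/other //] := eqVneq v v0.
have := @xsum_inc z xpredT; rewrite (bigD1 v0) //= big1 ?addbF; last by move=> w /other.
by move=> <-; rewrite /xsum big1 // => e _; rewrite andbF.
Qed.

(** By [parity_last], two subsets of [E] with equal parities on [S :\ v0] differ by a cycle; hence
    no fibre of the boundary map is larger than the cycle space. *)
Lemma card_cycles E S v0 : v0 \in S -> spans S E ->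
  2 ^ #|E| <= #|cycles E| * 2 ^ #|S|.-1.
Proof.
move=> v0S ES.
pose P : {set {set A + B}} := powerset (S :\ v0).
pose f z := [set v in S :\ v0 | parity z v].
have -> : #|S|.-1 = #|S :\ v0| by rewrite (cardsD1 v0 S) v0S.
rewrite -!card_powerset -sum1_card.
rewrite (partition_big f (mem P)) /=; last first.
  by move=> z _; rewrite /P powersetE; apply/subsetP => v; rewrite inE => /andP[].
apply: (@leq_trans (\sum_(y in P) #|cycles E|)); last by rewrite sum_nat_const mulnC.
apply: leq_sum => y _.
rewrite sum1dep_card; set Q := finset _.
have [->|[z0 z0P]] := set_0Vmem Q; first by rewrite cards0.
move: z0P; rewrite inE powersetE => /andP[z0E /eqP fz0].
have inj : injective (fun z => symdiff z z0).
  move=> z z' /setP h; apply/setP => e; have := h e; rewrite !inE.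
  by case: (e \in z); case: (e \in z'); case: (e \in z0).
rewrite -(card_imset _ inj); apply: subset_leq_card; apply/subsetP => _ /imsetP[z zQ ->].
move: zQ; rewrite inE powersetE -fz0 => /andP[zE /eqP fz]; apply/cyclesP.
have sub : symdiff z z0 \subset E.
  apply/subsetP => e; rewrite inE.
  by case: (boolP (e \in z)) => [/(subsetP zE)|_ /=] // /(subsetP z0E).
split=> //; apply: (parity_last v0S); first by move=> e /(subsetP sub)/ES.
move=> v vS; rewrite /parity xsum_symdiff -!/(parity _ _).
have := congr1 (fun s : {set A + B} => v \in s) fz; rewrite !inE.
by move: vS; rewrite !inE => -> /= ->; rewrite addbb.
Qed.

Lemma size_leq_card (I : finType) (s : {set I}) (l : seq I) :
  uniq l -> {subset l <= s} -> size l <= #|s|.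
Proof.
move=> ul sub; rewrite -(card_uniqP ul); apply: subset_leq_card.
by apply/subsetP => x /sub.
Qed.

(* [ph e s] is to be thought of as the parity of the winding number of a cycle
   around a point on side [s] of [e]; the values of [ph] play the part of the
   faces, and the two closing conditions say that every edge bounds at most two
   faces and that every face boundary can be continued at both ends of an edge. *)
Lemma bipartite_euler E S (ph : A * B -> bool -> {set A * B} -> bool) :
  E != set0 -> spans S E ->
  (forall e s z z', e \in E -> z \in cycles E -> z' \in cycles E ->
     ph e s (symdiff z z') = ph e s z (+) ph e s z') ->
  (forall e z, e \in E -> z \in cycles E -> ph e false z (+) ph e true z = (e \in z)) ->
  (forall e s b, e \in E -> exists f s',
     [/\ f \in E, f != e, end_of f b = end_of e b &
         {in cycles E, ph f s' =1 ph e s}]) ->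
  #|E| + 4 <= 2 * #|S|.
Proof.
move=> /set0Pn[e0 e0E] ES add jump turn.
(* A face is encoded as the set of cycles on which its functional is odd. *)
pose fs (p : (A * B) * bool) := [set z in cycles E | ph p.1 p.2 z].
pose D : {set (A * B) * bool} := setX E setT.
pose Phi := fs @: D.
have cD : #|D| = 2 * #|E| by rewrite cardsX cardsT card_bool mulnC.
have four : 4 * #|Phi| <= 2 * #|E|.
  rewrite -cD -[X in _ <= X]sum1_card (partition_big_imset fs) /= mulnC -sum_nat_const.
  apply: leq_sum => _ /imsetP[[e s] eD ->].
  have eE : e \in E by move: eD; rewrite in_setX => /andP[].
  rewrite sum1dep_card.
  (* Follow the face from [e] to [f] and [g] at its two ends, and from [f] on to [h]. Bipartiteness
     makes the four edges distinct. *)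
  have [f [s1 [fE fe fu fph]]] := turn e s false eE.
  have [g [s2 [gE ge gv gph]]] := turn e s true eE.
  have [h [s3 [hE hf hw hph]]] := turn f s1 true fE.
  apply: (@size_leq_card _ _ [:: (e, s); (f, s1); (g, s2); (h, s3)]).
    have ne p q x y : (p != q :> A * B) -> (p, x) != (q, y) :> A * B * bool.
      by apply: contra => /eqP[-> _].
    move: fu gv hw fe ge hf {fph gph hph fE gE hE eE eD}.
    case: e => e1 e2; case: f => f1 f2; case: g => g1 g2; case: h => h1 h2 /=.
    move=> [->] [->] [->]; rewrite !xpair_eqE !eqxx /= !andbT => fe ge hf.
    rewrite !inE !negb_or /= !xpair_eqE !(eq_sym e1) !(eq_sym e2).
    by rewrite (negbTE fe) (negbTE ge) (negbTE hf) !andbF.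
  have same q t : q \in E -> {in cycles E, ph q t =1 ph e s} ->
      (q, t) \in [set i in D | fs i == fs (e, s)].
    move=> qE qph; rewrite inE in_setX qE inE /=; apply/eqP/setP => z.
    by rewrite in_set [RHS]in_set /=; case: (boolP (z \in cycles E)) => //= /qph ->.
  move=> p; rewrite !in_cons in_nil orbF => /or4P[] /eqP ->; apply: same => //.
  by move=> z zc; rewrite hph // fph.
have inj : 2 * #|cycles E| <= 2 ^ #|Phi|.
  have <- : #|setX (cycles E) [set: bool]| = 2 * #|cycles E|.
    by rewrite cardsX cardsT card_bool mulnC.
  rewrite -card_powerset.
  (* The bit absorbs a constant: if two pairs have the same image, the sum of their cycles takes one
     value on all faces, so it jumps at no edge and is empty. *)
  pose m (p : {set A * B} * bool) := [set x in Phi | (p.1 \in x) (+) p.2].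
  rewrite -(@card_in_imset _ _ m).
    apply: subset_leq_card; apply/subsetP => _ /imsetP[p _ ->].
    by rewrite powersetE; apply/subsetP => x; rewrite inE => /andP[].
  move=> [z c] [z' c']; rewrite !in_setX => /andP[/= zc _] /andP[/= zc' _] /setP mm.
  have key e s : e \in E -> ph e s (symdiff z z') = c (+) c'.
    move=> eE; rewrite add //.
    have xP : fs (e, s) \in Phi by apply: imset_f; rewrite in_setX eE inE.
    have := mm (fs (e, s)); rewrite !inE xP /=.
    move: zc zc'; rewrite !inE => -> -> /=.
    by case: (ph _ _ z); case: (ph _ _ z'); case: (c); case: (c').
  have zz : z = z'.
    apply/setP => e; apply/eqP; apply: contraT => ne.
    have eE : e \in E.
      move: zc zc' => /cyclesP[/subsetP zE _] /cyclesP[/subsetP zE' _].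
      case: (boolP (e \in z)) => [/zE //|nz]; case: (boolP (e \in z')) => [/zE' //|nz'].
      by move: ne; rewrite (negbTE nz) (negbTE nz').
    have := jump e _ eE (cycles_symdiff zc zc').
    rewrite !key // addbb inE; move: ne.
    by case: (e \in z); case: (e \in z').
  congr pair => //; have := key e0 false e0E; rewrite add // zz addbb.
  by case: (c); case: (c').
have v0S := ES e0 e0E false.
have cnt := card_cycles v0S ES.
have SP : 0 < #|S| by apply/card_gt0P; exists (end_of e0 false).
(* Comparing exponents gives |E| + 1 <= |Phi| + |S| - 1, where [four] bounds |Phi| by |E| / 2. *)
have : 2 ^ (#|E| + 1) <= 2 ^ (#|Phi| + #|S|.-1).
  rewrite !expnD; apply: (@leq_trans (#|cycles E| * 2 ^ #|S|.-1 * 2)).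
    by rewrite leq_mul2r cnt orbT.
  by rewrite mulnAC leq_mul2r mulnC inj orbT.
by rewrite leq_exp2l //; lia.
Qed.

(** * Deletion of vertices of low degree *)

Definition degree E v := #|[set e in E | inc e v]|.

Lemma incP e v : reflect (exists b, v = end_of e b) (inc e v).
Proof.
apply: (iffP idP).
  by rewrite /inc; case: eqVneq => [->|_]; [exists false|case: eqVneq => [->|]; [exists true|]].
by case=> -[] ->; rewrite /inc eqxx.
Qed.

(** Deleting a vertex of degree at most two lowers |E| by at most two and 2 |S| by exactly two, so
    induction runs until three vertices are left or [core] applies. [Good] will be [drawing], which
    passes to subsets of edges. *)
Lemma delete_low_degree (Good : {set A * B} -> Prop) :
  (forall E F, F \subset E -> Good E -> Good F) ->
  (forall E S, Good E -> spans S E -> E != set0 ->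
     (forall v, v \in S -> 2 <= degree E v) -> #|E| + 4 <= 2 * #|S|) ->
  forall E S, Good E -> spans S E -> 3 <= #|S| -> #|E| + 4 <= 2 * #|S|.
Proof.
move=> her core E S; have [n] := ubnP #|S|; elim: n E S => // n IH E S ltn gE ES S3.
have [S4|S4] := ltnP 3 #|S|; last first.
  have cS : #|S| = 3 by lia.
  pose X := [set a : A | inl a \in S]; pose Y := [set b : B | inr b \in S].
  have cXY : #|X| + #|Y| = 3.
    rewrite -cS -(card_imset X (@inl_inj A B)) -(card_imset Y (@inr_inj A B)).
    rewrite -cardsUI (_ : _ :&: _ = set0) ?cards0 ?addn0.
      congr #|pred_of_set _|; apply/setP => -[a|b]; rewrite inE.
        rewrite (mem_imset _ _ (@inl_inj A B)) inE orbC; case: imsetP => // -[] //.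
      rewrite (mem_imset _ _ (@inr_inj A B)) inE; case: imsetP => // -[] //.
    apply/setP => v; rewrite !inE; apply/negP => /andP[/imsetP[a _ ->] /imsetP[b _]] //.
  (* Colour classes of total size three have at most two edges between them. *)
  have : #|E| <= #|setX X Y|.
    apply: subset_leq_card; apply/subsetP => -[a b] abE.
    by rewrite in_setX !inE (ES _ abE false) (ES _ abE true).
  rewrite cardsX cS; have : #|X| <= 3 by lia.
  by move: cXY; case: #|X| => [|[|[|[|k]]]]; case: #|Y| => [|[|[|[|l]]]] //; lia.
have [/existsP[v /andP[vS dv]]|] := boolP [exists v, (v \in S) && (degree E v <= 2)].
  pose F := [set e in E | ~~ inc e v].
  have FE : F \subset E by apply/subsetP => e; rewrite inE => /andP[].
  have FS : spans (S :\ v) F.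
    move=> e; rewrite inE => /andP[eE nev] b; rewrite !inE (ES e eE b) andbT.
    by apply: contra nev => /eqP <-; apply/incP; exists b.
  have cS := cardsD1 v S; rewrite vS in cS.
  have := IH F (S :\ v) ltac:(lia) (her _ _ FE gE) FS ltac:(lia).
  have : #|E| <= #|F| + degree E v.
    rewrite -(cardsID [set e | inc e v] E) addnC leq_add //; apply: subset_leq_card;
      by apply/subsetP => e; rewrite !inE andbC.
  by lia.
rewrite negb_exists => /forallP hi.
have deg v : v \in S -> 2 < degree E v by move=> vS; have := hi v; rewrite vS -ltnNge.
apply: core => //; last by move=> v /deg/ltnW.
have [v vS] : exists v, v \in S by apply/card_gt0P; lia.
have /card_gt0P[e] : 0 < degree E v by have := deg v vS; lia.
by rewrite inE => /andP[eE _]; apply/set0Pn; exists e.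
Qed.

End Bipartite.

Local Open Scope R_scope.

(** * Polygonal drawings *)

(** The minimum of finitely many radii; it makes choices uniform over edges, vertices or
    segments. *)
Lemma finite_pos (I : finType) (P : I -> R -> Prop) :
  (forall i d d', 0 < d' <= d -> P i d -> P i d') ->
  (forall i, exists2 d, 0 < d & P i d) -> exists2 d, 0 < d & forall i, P i d.
Proof.
move=> mono ex.
suff [d d0 Hd] : exists2 d, 0 < d & forall i, i \in enum I -> P i d.
  by exists d => // i; apply: Hd; rewrite mem_enum.
elim: (enum I) => [|i s [d d0 Hd]]; first by exists 1; [lra|].
have [d' d'0 Hd'] := ex i.
exists (Rmin d d'); first exact: Rmin_pos.
have m0 := Rmin_pos _ _ d0 d'0.
move=> j; rewrite in_cons => /orP[/eqP ->|js].
  by apply: mono Hd'; split=> //; apply: Rmin_r.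
by apply: mono (Hd j js); split=> //; apply: Rmin_l.
Qed.

Lemma finite_argmin (I : eqType) (s : seq I) (F : I -> R) x : x \in s ->
  exists2 i, i \in s & forall j, j \in s -> F i <= F j.
Proof.
elim: s x => // y s IH x _; case: s IH => [_|z s IH].
  by exists y; rewrite ?mem_head // => j; rewrite inE => /eqP ->; lra.
have [i is_ Hi] := IH z (mem_head _ _).
case: (Rle_lt_dec (F y) (F i)) => yi.
  exists y; first exact: mem_head.
  by move=> j; rewrite in_cons => /orP[/eqP ->|/Hi]; lra.
exists i; first by rewrite in_cons is_ orbT.
by move=> j; rewrite in_cons => /orP[/eqP ->|/Hi]; lra.
Qed.

Lemma near_seg d x y w : 0 < d -> near d x y -> on_seg x y w -> near d x w.
Proof.
move=> d0 [n1 n2] [t t01 ->]; rewrite /near /=.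
split; rewrite Rabs_minus_sym.
  have -> : x.1 + t * (y.1 - x.1) - x.1 = t * (y.1 - x.1) by ring.
  rewrite Rabs_mult (Rabs_pos_eq t); last lra.
  rewrite Rabs_minus_sym in n1; have := Rabs_pos (y.1 - x.1); nra.
have -> : x.2 + t * (y.2 - x.2) - x.2 = t * (y.2 - x.2) by ring.
rewrite Rabs_mult (Rabs_pos_eq t); last lra.
rewrite Rabs_minus_sym in n2; have := Rabs_pos (y.2 - x.2); nra.
Qed.

Lemma near_chord d x p q w : near d x p -> near d x q -> on_seg p q w -> near d x w.
Proof.
move=> [p1 p2] [q1 q2] [t t01 ->]; rewrite /near /=.
move: p1 p2 q1 q2 => /Rabs_def2 ? /Rabs_def2 ? /Rabs_def2 ? /Rabs_def2 ?.
have conv u v : u < d -> v < d -> (1 - t) * u + t * v < d.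
  by move=> ud vd; case: (Rle_lt_dec u v) => uv; nra.
have c1 := conv (x.1 - p.1) (x.1 - q.1); have c2 := conv (p.1 - x.1) (q.1 - x.1).
have c3 := conv (x.2 - p.2) (x.2 - q.2); have c4 := conv (p.2 - x.2) (q.2 - x.2).
by split; apply: Rabs_def1; lra.
Qed.

Definition chain (f : nat -> pt) (n : nat) (p : pt) : bool :=
  \big[addb/false]_(i < n) ray_up (f i) (f i.+1) p.

(** Telescoping: the [ray_down] terms of inner vertices occur twice, and only those of the two end
    points survive. *)
Lemma chain_ray f n p q :
  chain f n p (+) chain f n q (+) (ray_down p q (f 0%N) (+) ray_down p q (f n)) =
  \big[addb/false]_(i < n) (ray_up (f i) (f i.+1) p (+) ray_up (f i) (f i.+1) q (+)
     (ray_down p q (f i) (+) ray_down p q (f i.+1))).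
Proof.
elim: n => [|n IH]; first by rewrite /chain !big_ord0 /= addbb.
rewrite big_ord_recr /= -IH /chain !big_ord_recr /= -!/(chain _ _ _).
move: (chain _ _ _) (chain _ _ _) (ray_up _ _ _) (ray_up _ _ _) => a b c d.
by move: (ray_down _ _ _) (ray_down _ _ _) (ray_down _ _ _) => [] [] []; case: a; case: b; case: c; case: d.
Qed.

(** * Squared distances and angles *)

Definition dist2 (x y : pt) : R := (x.1 - y.1) * (x.1 - y.1) + (x.2 - y.2) * (x.2 - y.2).

(** A substitute for the triangle inequality without square roots, by the parallelogram law. *)
Lemma dist2_triangle x y w : dist2 x w <= 2 * (dist2 x y + dist2 y w).
Proof.
rewrite /dist2.
have := Rle_0_sqr (x.1 - 2 * y.1 + w.1); have := Rle_0_sqr (x.2 - 2 * y.2 + w.2).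
rewrite /Rsqr; nra.
Qed.

Lemma dist2_sym x y : dist2 x y = dist2 y x.
Proof. by rewrite /dist2; ring. Qed.

Lemma angle_exists a c : a * a + c * c = 1 -> a <> 1 ->
  exists2 th, 0 < th < 2 * PI & cos th = a /\ sin th = c.
Proof.
move=> ac a1; have a11 : -1 <= a <= 1 by nra.
have Hc := cos_acos a a11; have [b0 b1] := acos_bound a; have := PI_RGT_0 => pi0.
have a0 : acos a <> 0 by move=> h; apply: a1; rewrite -Hc h cos_0.
have s0 : 0 <= sin (acos a) by apply: sin_ge_0; lra.
have := sin2_cos2 (acos a); rewrite /Rsqr Hc => sc.
case: (Rle_lt_dec 0 c) => c0.
  exists (acos a); first lra.
  split=> //; nra.
exists (2 * PI - acos a); first by lra.
rewrite cos_minus sin_minus cos_2PI sin_2PI Hc; split; nra.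
Qed.

Lemma cos_eq1 x : - (2 * PI) < x < 2 * PI -> cos x = 1 -> x = 0.
Proof.
move=> x2 cx; have := cos_2a_sin (x / 2); have -> : 2 * (x / 2) = x by field.
rewrite cx => e; have s0 : sin (x / 2) = 0 by nra.
case: (Rtotal_order x 0) => [h|[//|h]]; exfalso.
  have := sin_gt_0 (- (x / 2)); rewrite sin_neg; lra.
have := sin_gt_0 (x / 2); lra.
Qed.

Lemma cos_sin_inj s t : - (2 * PI) < s - t < 2 * PI ->
  cos s = cos t -> sin s = sin t -> s = t.
Proof.
move=> st ec es; suff : s - t = 0 by lra.
apply: cos_eq1 => //; rewrite cos_minus ec es.
by have := sin2_cos2 t; rewrite /Rsqr; lra.
Qed.

Section Drawing.
Variables A B : finType.
Variables (pos : A + B -> pt) (pl : A * B -> nat -> pt) (len : A * B -> nat) (r : R).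
Implicit Types (E F z : {set A * B}) (e f : A * B).

Definition exit_pt e (b : bool) : pt := if b then pl e (len e).-1 else pl e 1%N.
Definition mid e (i : nat) : bool := (0 < i < (len e).-1)%N.
Definition on_edge e (x : pt) : Prop :=
  exists2 i, (i < len e)%N & on_seg (pl e i) (pl e i.+1) x.

(* The first and last segments of [pl e] are radii of length [2 r]; the others stay
   at distance more than [r] from all vertices, so that the circle of radius [r]
   around a vertex meets the drawing in the midpoints of the radii only. *)
Record drawing E : Prop := Drawing {
  r_gt0 : 0 < r;
  len_gt2 : forall e, e \in E -> (2 < len e)%N;
  pl_src : forall e, e \in E -> pl e 0%N = pos (end_of e false);
  pl_tgt : forall e, e \in E -> pl e (len e) = pos (end_of e true);
  exit_dist : forall e b, e \in E ->
    dist2 (exit_pt e b) (pos (end_of e b)) = 4 * (r * r);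
  pos_far : forall u v, u != v -> 16 * (r * r) < dist2 (pos u) (pos v);
  mid_far : forall e i x v, e \in E -> mid e i -> on_seg (pl e i) (pl e i.+1) x ->
    r * r < dist2 x (pos v);
  mid_disj : forall e f i x, e \in E -> f \in E -> e != f -> mid e i ->
    on_seg (pl e i) (pl e i.+1) x -> ~ on_edge f x;
  exit_neq : forall e f b, e \in E -> f \in E -> e != f -> end_of e b = end_of f b ->
    exit_pt e b <> exit_pt f b }.

Lemma drawing_sub E F : F \subset E -> drawing E -> drawing F.
Proof.
move=> /subsetP FE D; split; first exact: (r_gt0 D).
all: try (by move=> e /FE; apply: (len_gt2 D)).
all: try (by move=> e /FE; apply: (pl_src D)).
all: try (by move=> e /FE; apply: (pl_tgt D)).
- by move=> e b /FE; apply: (exit_dist D).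
- exact: (pos_far D).
- by move=> e i x v /FE; apply: (mid_far D).
- by move=> e f i x /FE eE /FE; apply: (mid_disj D).
by move=> e f b /FE eE /FE; apply: (exit_neq D).
Qed.

(** * Parities of winding numbers *)

Definition winding z p := xsum z (fun e => chain (pl e) (len e) p).

Variable E : {set A * B}.
Hypothesis D : drawing E.

(** After telescoping, the extra [ray_down] terms sit at the end points of the edges and cancel by
    [xsum_inc], since [z] is a cycle. The change of [winding] thus becomes a sum of local terms, one
    for each segment, controlled by [ray_meet] and [ray_cross]. *)
Lemma winding_ray z p q : z \in cycles E ->
  winding z p (+) winding z q = xsum z (fun e => \big[addb/false]_(i < len e)
    (ray_up (pl e i) (pl e i.+1) p (+) ray_up (pl e i) (pl e i.+1) q (+)
     (ray_down p q (pl e i) (+) ray_down p q (pl e i.+1)))).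
Proof.
move=> /cyclesP[/subsetP zE zp].
rewrite (eq_xsum (G := fun e => (chain (pl e) (len e) p (+) chain (pl e) (len e) q) (+)
   (ray_down p q (pos (end_of e false)) (+) ray_down p q (pos (end_of e true))))).
  rewrite !xsum_addb -/(winding z p) -/(winding z q) -xsum_addb (xsum_inc z (fun v => ray_down p q (pos v))).
  by rewrite big1 ?addbF // => v _; rewrite zp andbF.
by move=> e /zE eE; rewrite -chain_ray (pl_src D) // (pl_tgt D).
Qed.

Lemma no_cross a b p q : (forall x, on_seg p q x -> ~ on_seg a b x) ->
  ray_up a b p (+) ray_up a b q (+) (ray_down p q a (+) ray_down p q b) = false.
Proof.
move=> dis; apply/negbTE/negP => h.
have [|x xab xpq] := @ray_meet a b p q; last exact: (dis x).
by move=> eq; move: h; rewrite eq addbb.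
Qed.

Lemma winding_move z p q : z \in cycles E ->
  (forall e x, e \in z -> on_seg p q x -> ~ on_edge e x) -> winding z p = winding z q.
Proof.
move=> zc dis; apply/eqP; rewrite -[_ == _]negbK -negb_add winding_ray // negbK.
rewrite /xsum big1 // => e _; case: (boolP (e \in z)) => //= ez.
rewrite big1 // => i _; apply: no_cross => x xpq xe.
by apply: (dis e x ez xpq); exists i.
Qed.

Lemma winding_cross z p q e k s t : z \in cycles E -> e \in z -> (k < len e)%N ->
  0 < s < 1 -> 0 < t < 1 -> lerp (pl e k) (pl e k.+1) s = lerp p q t ->
  det (pl e k) (pl e k.+1) p <> det (pl e k) (pl e k.+1) q ->
  (forall f x, f \in z -> f != e -> on_seg p q x -> ~ on_edge f x) ->
  (forall i x, (i < len e)%N -> i != k -> on_seg p q x -> ~ on_seg (pl e i) (pl e i.+1) x) ->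
  winding z p (+) winding z q.
Proof.
move=> zc ez ke s01 t01 cr nd dis1 dis2; rewrite winding_ray // /xsum (bigD1 e) //= ez /=.
rewrite [X in _ (+) X]big1 ?addbF.
  rewrite (bigD1 (Ordinal ke)) //= (ray_cross s01 t01 cr nd) big1 // => i ik.
  by apply: no_cross => x; apply: dis2.
move=> f fe; case: (boolP (f \in z)) => //= fz.
rewrite big1 // => i _; apply: no_cross => x xpq xe.
by apply: (dis1 f x fz fe xpq); exists i.
Qed.

Lemma edge_open e x : ~ on_edge e x ->
  exists2 d, 0 < d & forall y, near d x y -> ~ on_edge e y.
Proof.
move=> ne.
have [||d d0 Hd] := @finite_pos 'I_(len e) (fun i d => forall y, near d x y -> ~ on_seg (pl e i) (pl e i.+1) y).
- by move=> i d d' dd' H y [n1 n2]; apply: H; split; lra.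
- by move=> i; apply: seg_open => h; apply: ne; exists i.
by exists d => // y ny [i ie]; apply: (Hd (Ordinal ie)).
Qed.

Lemma edges_open (P : pred (A * B)) x : (forall e, P e -> ~ on_edge e x) ->
  exists2 d, 0 < d & forall y e, near d x y -> P e -> ~ on_edge e y.
Proof.
move=> ne.
have [||d d0 Hd] := @finite_pos (A * B)%type (fun e d => forall y, near d x y -> P e -> ~ on_edge e y).
- by move=> i d d' dd' H y [n1 n2]; apply: H; split; lra.
- move=> e; case: (boolP (P e)) => [/ne/edge_open[d d0 Hd]|nP]; last by exists 1; [lra|].
  by exists d => // y ny _; apply: Hd.
by exists d => // y e ny; apply: Hd.
Qed.

Lemma winding_path z (g : R -> pt) a b : z \in cycles E -> a <= b ->
  (forall t, continuity_pt (fun t => (g t).1) t) ->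
  (forall t, continuity_pt (fun t => (g t).2) t) ->
  (forall t e, a <= t <= b -> e \in z -> ~ on_edge e (g t)) -> winding z (g a) = winding z (g b).
Proof.
move=> zc ab c1 c2 dis; apply: (locally_constant_eq (P := fun t => winding z (g t)) ab) => t tab.
have [|d d0 Hd] := @edges_open (mem z) (g t); first by move=> e; apply: dis.
have [d1 [d10 H1]] := c1 t d d0; have [d2 [d20 H2]] := c2 t d d0.
exists (Rmin d1 d2); first exact: Rmin_pos.
move=> t' t'ab tt'; symmetry; apply: winding_move => // e x ez xs; apply: Hd ez.
apply: near_seg xs => //; case: (Req_dec t t') => [<-|ne].
  by rewrite /near !Rminus_diag Rabs_R0.
have := Rmin_l d1 d2; have := Rmin_r d1 d2 => m1 m2.
split; rewrite Rabs_minus_sym; [apply: (H1 t')|apply: (H2 t')]; split; try (by split).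
  by apply: Rlt_le_trans tt' _.
by apply: Rlt_le_trans tt' _.
Qed.

(** * Radii and circles around vertices *)

Definition radial e b s : pt := lerp (pos (end_of e b)) (exit_pt e b) s.
Definition rad_idx e (b : bool) : nat := if b then (len e).-1 else 0%N.

Lemma radial_seg e b x : e \in E ->
  on_seg (pl e (rad_idx e b)) (pl e (rad_idx e b).+1) x <->
  exists2 s, 0 <= s <= 1 & x = radial e b s.
Proof.
move=> eE; have l2 := len_gt2 D eE; rewrite /radial /rad_idx; case: b => /=; last first.
  by rewrite -(pl_src D).
rewrite prednK; last by lia.
rewrite -(pl_tgt D) // /exit_pt.
(* The last segment runs towards its vertex and the radius away from it, hence the reversal. *)
by split=> -[s s01 ->]; exists (1 - s); try lra; rewrite /lerp; congr pair; ring.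
Qed.

Lemma idx_cases e i : e \in E -> (i < len e)%N -> mid e i \/ exists b, i = rad_idx e b.
Proof.
move=> eE il; have l2 := len_gt2 D eE; rewrite /mid /rad_idx.
case: (posnP i) => [->|i0]; first by right; exists false.
case: (ltnP i (len e).-1) => h; first by left.
by right; exists true; lia.
Qed.

Lemma rad_idx_lt e b : e \in E -> (rad_idx e b < len e)%N.
Proof. by move=> eE; have := len_gt2 D eE; rewrite /rad_idx; case: b; lia. Qed.

Lemma radial_on_edge e b s : e \in E -> 0 <= s <= 1 -> on_edge e (radial e b s).
Proof.
move=> eE s01; exists (rad_idx e b); first exact: rad_idx_lt.
by apply/radial_seg => //; exists s.
Qed.

Lemma radial_dist e b s : e \in E ->
  dist2 (radial e b s) (pos (end_of e b)) = s * s * (4 * (r * r)).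
Proof. by move=> eE; rewrite -(exit_dist D b eE) /dist2 /radial /lerp /=; ring. Qed.

Lemma ends_eq e f b c : end_of e b = end_of f c -> b = c.
Proof. by case: b; case: c. Qed.

(** Radii at distinct vertices are too far apart. Radii with the same centre can share another point
    only at equal parameters, and then their exit points agree. The centre itself is excluded by
    [0 < s]. *)
Lemma radial_disj e f b s : e \in E -> f \in E -> f != e -> 0 < s <= 1 ->
  ~ on_edge f (radial e b s).
Proof.
move=> eE fE fe s01 [i il].
have r0 := r_gt0 D; have rr : 0 < r * r by nra.
have [im|[c ->]] := idx_cases fE il.
  by move/(mid_disj D fE eE fe im); apply; apply: radial_on_edge => //; lra.
move/(radial_seg c _ fE) => [s' s'01 ex].
have d1 := radial_dist b s eE; have d2 := radial_dist c s' fE; rewrite -ex in d2.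
have [eq|ne] := eqVneq (end_of e b) (end_of f c); last first.
  (* A common point would be within [2 r] of both vertices, whose squared distance would be at most
     2 (4 + 4) = 16 times [r * r]. *)
  have := pos_far D ne; have := dist2_triangle (pos (end_of e b)) (radial e b s) (pos (end_of f c)).
  rewrite d2 [dist2 _ (radial _ _ _)]dist2_sym d1.
  have : s * s <= 1 by nra. have : s' * s' <= 1 by nra. nra.
have bc := ends_eq eq; subst c; rewrite eq d2 in d1.
have ss : s = s'.
  have : s' * s' = s * s by apply: (Rmult_eq_reg_r (4 * (r * r))); lra.
  nra.
subst s'; rewrite eq_sym in fe; apply: (exit_neq D eE fE fe eq).
move: ex; rewrite /radial eq /lerp => -[e1 e2].
by case: (exit_pt e b) (exit_pt f b) e1 e2 => x1 x2 [y1 y2] /= e1 e2; congr pair; nra.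
Qed.

Lemma circle_hit e x u : e \in E -> on_edge e x -> dist2 x (pos u) = r * r ->
  exists2 b, u = end_of e b & x = radial e b (1/2).
Proof.
move=> eE [i il] xe xu; have r0 := r_gt0 D; have rr : 0 < r * r by nra.
have [im|[b ib]] := idx_cases eE il.
  by have := mid_far D u eE im xe; lra.
subst i; move/(radial_seg b _ eE): xe => [s s01 ex].
have d1 := radial_dist b s eE; rewrite -ex in d1.
have [eq|ne] := eqVneq u (end_of e b).
  exists b => //; rewrite ex; congr radial; rewrite -eq xu in d1.
  have : s * s = 1 / 4 by apply: (Rmult_eq_reg_r (4 * (r * r))); lra.
  nra.
have := pos_far D ne; have := dist2_triangle (pos u) x (pos (end_of e b)).
rewrite d1 [dist2 _ x]dist2_sym xu; have : s * s <= 1 by nra. nra.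
Qed.

Lemma half_radial_seg e b i : e \in E -> (i < len e)%N -> i != rad_idx e b ->
  ~ on_seg (pl e i) (pl e i.+1) (radial e b (1/2)).
Proof.
move=> eE il ne xe; have r0 := r_gt0 D; have rr : 0 < r * r by nra.
have d1 := radial_dist b (1/2) eE.
have [im|[c ic]] := idx_cases eE il.
  by have := mid_far D (end_of e b) eE im xe; lra.
subst i; move/(radial_seg c _ eE): xe => [s s01 ex].
have d2 := radial_dist c s eE; rewrite -ex in d2.
have nbc : end_of e b != end_of e c.
  by apply/eqP => /ends_eq h; move: ne; rewrite h eqxx.
have := pos_far D nbc; have := dist2_triangle (pos (end_of e b)) (radial e b (1/2)) (pos (end_of e c)).
rewrite d2 [dist2 _ (radial _ _ _)]dist2_sym d1; have : s * s <= 1 by nra. nra.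
Qed.

Definition sgn (s : bool) : R := if s then 1 else -1.

(** The midpoint of the radius turned by the angle [t] about the vertex, counterclockwise if [s] is
    [true]. For small [t], the bit [s] names a side of the edge. *)
Definition turn_pt e b (s : bool) (t : R) : pt :=
  let c := pos (end_of e b) in let q := exit_pt e b in
  let dx := (q.1 - c.1) / 2 in let dy := (q.2 - c.2) / 2 in
  (c.1 + (dx * cos t - sgn s * dy * sin t), c.2 + (dy * cos t + sgn s * dx * sin t)).

Lemma sgn2 s : sgn s * sgn s = 1. Proof. by case: s => /=; ring. Qed.

Lemma turn0 e b s : turn_pt e b s 0 = radial e b (1/2).
Proof. by rewrite /turn_pt /radial /lerp cos_0 sin_0; congr pair; field. Qed.

Lemma turn_cont1 e b s t : continuity_pt (fun t => (turn_pt e b s t).1) t.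
Proof. by rewrite /turn_pt /=; reg. Qed.

Lemma turn_cont2 e b s t : continuity_pt (fun t => (turn_pt e b s t).2) t.
Proof. by rewrite /turn_pt /=; reg. Qed.

Lemma turn_dist e b s t : e \in E -> dist2 (turn_pt e b s t) (pos (end_of e b)) = r * r.
Proof.
move=> eE; have := exit_dist D b eE; rewrite /dist2 /turn_pt /=.
have := sin2_cos2 t; rewrite /Rsqr; have := sgn2 s.
move: (sgn s) (cos t) (sin t) (exit_pt e b) (pos (end_of e b)) => g c n [q1 q2] [c1 c2] /= gg cn dd.
have -> : forall u v, (c1 + u - c1) * (c1 + u - c1) + (c2 + v - c2) * (c2 + v - c2) = u * u + v * v by move=> u v; ring.
have -> : forall x y, (x * c - g * y * n) * (x * c - g * y * n) + (y * c + g * x * n) * (y * c + g * x * n) = (x * x + y * y) * (c * c) + (g * g) * (x * x + y * y) * (n * n) by move=> x y; ring.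
rewrite gg; set m := (q1 - c1) / 2; set k := (q2 - c2) / 2.
have : m * m + k * k = r * r by rewrite /m /k; lra.
by move=> ->; nra.
Qed.

Lemma turn_inj e b s t t' : e \in E -> - (2 * PI) < t - t' < 2 * PI ->
  turn_pt e b s t = turn_pt e b s t' -> t = t'.
Proof.
move=> eE tt [] e1 e2; have r0 := r_gt0 D.
have := exit_dist D b eE; rewrite /dist2; have := sgn2 s.
move: e1 e2; move: (sgn s) (exit_pt e b) (pos (end_of e b)) => g [q1 q2] [c1 c2] /= e1 e2 gg dd.
move: e1 e2; set m := (q1 - c1) / 2; set k := (q2 - c2) / 2 => e1 e2.
have mk : m * m + k * k = r * r by rewrite /m /k; lra.
have rr : r * r <> 0 by nra.
apply: cos_sin_inj => //; apply: (Rmult_eq_reg_l (r * r)) => //; rewrite -mk.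
  have -> : forall c, (m * m + k * k) * cos c = m * (m * cos c - g * k * sin c) + k * (k * cos c + g * m * sin c) by move=> c; ring.
  have -> : m * cos t - g * k * sin t = m * cos t' - g * k * sin t' by lra.
  have -> : k * cos t + g * m * sin t = k * cos t' + g * m * sin t' by lra.
  by ring.
have -> : forall c, (m * m + k * k) * sin c = g * (m * (k * cos c + g * m * sin c) - k * (m * cos c - g * k * sin c)).
  by move=> c; transitivity (g * g * (m * m + k * k) * sin c); [rewrite gg; ring|ring].
have -> : m * cos t - g * k * sin t = m * cos t' - g * k * sin t' by lra.
have -> : k * cos t + g * m * sin t = k * cos t' + g * m * sin t' by lra.
by transitivity (g * g * (m * m + k * k) * sin t'); [ring|rewrite gg; ring].
Qed.

(** Cosine and sine of the angle between the two radii are inner and cross product divided by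
    [r * r], up to the orientation. Turning back from [f] reverses the orientation, hence [~~ s]. *)
Lemma turn_angle e f b s : e \in E -> f \in E -> f != e -> end_of f b = end_of e b ->
  exists2 th, 0 < th < 2 * PI &
    turn_pt e b s th = radial f b (1/2) /\
    forall t, turn_pt e b s (th - t) = turn_pt f b (~~ s) t.
Proof.
move=> eE fE fe ends; have r0 := r_gt0 D.
have ne := exit_neq D fE eE fe ends.
have := exit_dist D b eE; have := exit_dist D b fE; rewrite /dist2 /radial /turn_pt ends.
have := sgn2 s; have -> : sgn (~~ s) = - sgn s by case: s => /=; ring.
move: ne; move: (sgn s) (exit_pt e b) (exit_pt f b) (pos (end_of e b)) => g [q1 q2] [p1 p2] [c1 c2] /=.
move=> ne gg d1 d2.
set m := (q1 - c1) / 2; set k := (q2 - c2) / 2.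
set m' := (p1 - c1) / 2; set k' := (p2 - c2) / 2.
have mk : m * m + k * k = r * r by rewrite /m /k; lra.
have mk' : m' * m' + k' * k' = r * r by rewrite /m' /k'; lra.
have rr : r * r <> 0 by nra.
pose a := (m * m' + k * k') / (r * r); pose c := g * (m * k' - k * m') / (r * r).
have am : a * (r * r) = m * m' + k * k' by rewrite /a; field; lra.
have cm : c * (r * r) = g * (m * k' - k * m') by rewrite /c; field; lra.
have ac : a * a + c * c = 1.
  apply: (Rmult_eq_reg_r ((r * r) * (r * r))); last by nra.
  transitivity ((a * (r * r)) * (a * (r * r)) + (c * (r * r)) * (c * (r * r))); first by ring.
  rewrite am cm; transitivity ((m * m' + k * k') * (m * m' + k * k') + (g * g) * ((m * k' - k * m') * (m * k' - k * m'))); first by ring.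
  rewrite gg; transitivity ((m * m + k * k) * (m' * m' + k' * k')); first by ring.
  by rewrite mk mk'; ring.
have m'E : m' = m * a - g * k * c.
  apply: (Rmult_eq_reg_r (r * r)) => //.
  transitivity (m * (a * (r * r)) - g * k * (c * (r * r))); last by ring.
  rewrite am cm -mk; transitivity (m * (m * m' + k * k') - (g * g) * (k * (m * k' - k * m'))); last by ring.
  by rewrite gg; ring.
have k'E : k' = k * a + g * m * c.
  apply: (Rmult_eq_reg_r (r * r)) => //.
  transitivity (k * (a * (r * r)) + g * m * (c * (r * r))); last by ring.
  rewrite am cm -mk; transitivity (k * (m * m' + k * k') + (g * g) * (m * (m * k' - k * m'))); last by ring.
  by rewrite gg; ring.
have a1 : a <> 1.
  move=> h; have c0 : c = 0 by nra.
  apply: ne; rewrite h c0 in m'E k'E; move: m'E k'E; rewrite /m /m' /k /k' => ? ?.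
  by congr pair; lra.
have [th th2 [ct st]] := angle_exists ac a1.
exists th => //; split.
  rewrite ct st -m'E -k'E /lerp /=; congr pair; rewrite /m' /k'; field.
move=> t; rewrite cos_minus sin_minus ct st m'E k'E; congr pair; congr Rplus.
  transitivity (m * (a * cos t + c * sin t) - g * k * (c * cos t - a * sin t)); first by ring.
  transitivity ((m * a - g * k * c) * cos t + g * k * a * sin t + (g * g) * m * c * sin t); last by ring.
  by rewrite gg; ring.
transitivity ((k * a + g * m * c) * cos t - g * m * a * sin t + (g * g) * k * c * sin t); last by ring.
by rewrite gg; ring.
Qed.

End Drawing.

(** * Sides of edges and turning around vertices *)

Section Drawing2.
Variables A B : finType.
Variables (pos : A + B -> pt) (pl : A * B -> nat -> pt) (len : A * B -> nat) (r : R).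
Implicit Types (E F z : {set A * B}) (e f : A * B).
Variable E : {set A * B}.
Hypothesis D : drawing pos pl len r E.

Local Notation radial := (radial pos pl len).
Local Notation turn_pt := (turn_pt pos pl len).
Local Notation on_edge := (on_edge pl len).
Local Notation winding := (winding pl len).
Local Notation rad_idx := (rad_idx len).

Definition near_only_radial e b (y : pt) : Prop :=
  (forall f, f \in E -> f != e -> ~ on_edge f y) /\
  (forall i, (i < len e)%N -> i != rad_idx e b -> ~ on_seg (pl e i) (pl e i.+1) y).

Lemma near_radial_ball e b : e \in E ->
  exists2 d, 0 < d & forall y, near d (radial e b (1/2)) y -> near_only_radial e b y.
Proof.
move=> eE.
have [|d1 d10 H1] := @edges_open _ _ pl len (fun f => (f \in E) && (f != e)) (radial e b (1/2)).
  by move=> f /andP[fE fe]; apply: (radial_disj D) => //; lra.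
have [||d2 d20 H2] := @finite_pos 'I_(len e) (fun i d => i != rad_idx e b :> nat ->
    forall y, near d (radial e b (1/2)) y -> ~ on_seg (pl e i) (pl e i.+1) y).
- by move=> i d d' dd' H ne y [n1 n2]; apply: H => //; split; lra.
- move=> i; case: (boolP (i != rad_idx e b :> nat)) => [ne|eq].
    have [d d0 Hd] := seg_open (half_radial_seg D eE (ltn_ord i) ne).
    by exists d.
  by exists 1; [lra|move=> h; case/negP: eq].
exists (Rmin d1 d2); first exact: Rmin_pos.
have := Rmin_l d1 d2; have := Rmin_r d1 d2 => m2 m1 y [n1 n2]; split.
  by move=> f fE fe; apply: H1; [split; lra|rewrite fE].
by move=> i il ne; apply: (H2 (Ordinal il)) => //; split; lra.
Qed.

(** Below [PI / 2] the cosine is positive, so that the chord between the two sides crosses the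
    radius away from the vertex. *)
Definition small_turn e b (tau : R) : Prop := tau < PI / 2 /\
  forall s s' x, on_seg (turn_pt e b s tau) (turn_pt e b s' tau) x \/
    on_seg (turn_pt e b s tau) (radial e b (1/2)) x -> near_only_radial e b x.

Lemma small_turn_exists e b : e \in E ->
  exists2 tau, 0 < tau & forall t, 0 < t <= tau -> small_turn e b t.
Proof.
move=> eE; have [d d0 Hd] := near_radial_ball b eE; have pi0 := PI_RGT_0.
have loc s : exists2 t0, 0 < t0 & forall t, 0 < t <= t0 ->
    near d (radial e b (1/2)) (turn_pt e b s t).
  have [d1 [d10 H1]] := turn_cont1 pos pl len e b s 0 d0.
  have [d2 [d20 H2]] := turn_cont2 pos pl len e b s 0 d0.
  exists (Rmin d1 d2 / 2); first by have := Rmin_pos _ _ d10 d20; lra.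
  have := Rmin_l d1 d2; have := Rmin_r d1 d2 => m2 m1 t t0.
  rewrite -(turn0 pos pl len e b s); split; rewrite Rabs_minus_sym; [apply: (H1 t)|apply: (H2 t)].
    split; first by split=> //; lra.
    by rewrite /= /R_dist Rabs_pos_eq; lra.
  split; first by split=> //; lra.
  by rewrite /= /R_dist Rabs_pos_eq; lra.
have [t1 t10 H1] := loc true; have [t2 t20 H2] := loc false.
exists (Rmin (PI / 4) (Rmin t1 t2)); first by do !apply: Rmin_pos => //; lra.
have := Rmin_l (PI / 4) (Rmin t1 t2); have := Rmin_r (PI / 4) (Rmin t1 t2).
have := Rmin_l t1 t2; have := Rmin_r t1 t2 => m1 m2 m3 m4 t t0.
have nr s : near d (radial e b (1/2)) (turn_pt e b s t).
  by case: s; [apply: H1|apply: H2]; lra.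
have nr0 : near d (radial e b (1/2)) (radial e b (1/2)).
  by rewrite /near !Rminus_diag Rabs_R0.
split; first by lra.
by move=> s s' x [|] xs; apply: Hd; apply: near_chord xs.
Qed.

Lemma side_jump e b tau z : e \in E -> 0 < tau -> small_turn e b tau -> z \in cycles E ->
  winding z (turn_pt e b false tau) (+) winding z (turn_pt e b true tau) = (e \in z).
Proof.
move=> eE t0 [tpi sm] zc; have /cyclesP[/subsetP zE _] := zc.
have lon x : on_seg (turn_pt e b false tau) (turn_pt e b true tau) x -> near_only_radial e b x.
  by move=> xs; apply: sm; left; exact: xs.
have [ez|nez] := boolP (e \in z); last first.
  apply/negbTE; rewrite negb_add; apply/eqP; apply: (winding_move D) => // f x fz xs.
  have [h _] := lon x xs; apply: h; first exact: zE.
  by apply: contraNneq nez => <-.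
have r0 := r_gt0 D; have pi0 := PI_RGT_0.
have c0 : 0 < cos tau by apply: cos_gt_0; lra.
have s0 : 0 < sin tau by apply: sin_gt_0; lra.
have c1 : cos tau < 1 by have := sin2_cos2 tau; rewrite /Rsqr; nra.
have l2 := len_gt2 D eE.
have dd := exit_dist D b eE.
have dn : 0 < dist2 (exit_pt pl len e b) (pos (end_of e b)) * sin tau by rewrite dd; apply: Rmult_lt_0_compat => //; nra.
(* The chord meets the radius at parameter [cos tau / 2] from the vertex; the last segment is
   parametrized backwards. *)
pose u := if b then 1 - cos tau / 2 else cos tau / 2.
apply: (@winding_cross _ _ _ _ _ _ _ D z _ _ e (rad_idx e b) u (1/2)) => //.
- exact: (rad_idx_lt D).
- by rewrite /u; case: (b); lra.
- by lra.
- rewrite /u /rad_idx /turn_pt /lerp /sgn; case: (b); rewrite /exit_pt /= ?prednK; try lia.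
    by rewrite (pl_tgt D) //=; congr pair; field.
  by rewrite (pl_src D) //=; congr pair; field.
- move: dn; rewrite /rad_idx /turn_pt /det /dist2 /sgn; case: (b); rewrite /exit_pt /= ?prednK; try lia.
    by rewrite (pl_tgt D) //= => dn; nra.
  by rewrite (pl_src D) //= => dn; nra.
- by move=> f x fz fe xs; have [h _] := lon x xs; apply: h => //; apply: zE.
by move=> i x il ne xs; have [_ h] := lon x xs; apply: h.
Qed.

Lemma side_base e b s tau z : e \in E -> small_turn e b tau -> z \in cycles E -> e \notin z ->
  winding z (turn_pt e b s tau) = winding z (radial e b (1/2)).
Proof.
move=> eE [_ sm] zc nez; have /cyclesP[/subsetP zE _] := zc.
apply: (winding_move D) => // f x fz xs.
have [h _] : near_only_radial e b x by apply: (sm s s); right.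
by apply: h; [exact: zE|apply: contraNneq nez => <-].
Qed.

(** Walk along [e] itself: a cycle avoiding [e] meets neither its middle segments nor the outer
    halves of its radii. *)
Lemma along_edge e z : e \in E -> z \in cycles E -> e \notin z ->
  winding z (radial e false (1/2)) = winding z (radial e true (1/2)).
Proof.
move=> eE zc nez; have /cyclesP[/subsetP zE _] := zc.
have fe f : f \in z -> f != e by move=> fz; apply: contraNneq nez => <-.
have l2 := len_gt2 D eE.
have out b : winding z (radial e b (1/2)) = winding z (exit_pt pl len e b).
  apply: (winding_move D) => // f x fz [t t01 ->].
  have -> : lerp (radial e b (1/2)) (exit_pt pl len e b) t = radial e b ((1 + t) / 2).
    by rewrite /radial /lerp /=; congr pair; field.
  by apply: (radial_disj D) => //; [exact: zE|exact: fe|lra].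
have step i : (i.+1 < len e)%N -> winding z (pl e 1%N) = winding z (pl e i.+1).
  elim: i => // i IH il; rewrite IH; last by lia.
  apply: (winding_move D) => // f x fz; apply: (mid_disj D) => //; first exact: zE.
    by rewrite eq_sym fe.
  by rewrite /mid; lia.
rewrite !out /exit_pt (step (len e).-2); last by lia.
by have -> : (len e).-2.+1 = (len e).-1 by lia.
Qed.

(** Among the edges at the vertex take the one reached by the smallest angle; by [circle_hit] the
    open arc before it is free. *)
Lemma next_edge e b s : e \in E -> (2 <= degree E (end_of e b))%N ->
  exists f th, [/\ f \in E, f != e, end_of f b = end_of e b &
    0 < th /\ (forall t, turn_pt e b s (th - t) = turn_pt f b (~~ s) t) /\
    (forall t g, 0 < t < th -> g \in E -> ~ on_edge g (turn_pt e b s t))].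
Proof.
move=> eE deg; have pi0 := PI_RGT_0.
pose N := [set f in E | inc f (end_of e b) & f != e].
have N1 f : f \in N -> [/\ f \in E, f != e & end_of f b = end_of e b].
  rewrite inE => /and3P[fE /incP[c h] fe]; split=> //.
  by rewrite h; congr end_of; exact: (ends_eq h).
have N2 f : f \in E -> f != e -> end_of f b = end_of e b -> f \in N.
  by move=> fE fe h; rewrite inE fE fe andbT /=; apply/incP; exists b.
have [f0 f0N] : exists f, f \in N.
  apply/card_gt0P; move: deg; rewrite /degree (cardsD1 e) inE eE /=.
  have -> : inc e (end_of e b) by apply/incP; exists b.
  suff -> : [set f in E | inc f (end_of e b)] :\ e = N by rewrite add1n ltnS.
  by apply/setP => f; rewrite !inE andbC -andbA.
pose Q f th := 0 < th < 2 * PI /\ turn_pt e b s th = radial f b (1/2) /\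
    forall t, turn_pt e b s (th - t) = turn_pt f b (~~ s) t.
have ex f : exists th, f \in N -> Q f th.
  case: (boolP (f \in N)) => [/N1[fE fe h]|]; last by exists 0.
  by have [th th2 [h1 h2]] := turn_angle D s eE fE fe h; exists th.
pose F f := proj1_sig (constructive_indefinite_description _ (ex f)).
have HF f : f \in N -> Q f (F f) := proj2_sig (constructive_indefinite_description _ (ex f)).
have [|f fN fmin] := @finite_argmin _ (enum N) F f0; first by rewrite mem_enum.
rewrite mem_enum in fN; have [fE fe fend] := N1 f fN; have [F2 [Fr Ft]] := HF f fN.
exists f, (F f); split=> //; split; first by lra.
split=> // t g tF gE gon.
have [c gend gt] := circle_hit D gE gon (turn_dist D b s t eE).
have cb := ends_eq gend; subst c.
have [ge|ge] := eqVneq g e.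
  subst g; have := turn_inj (b := b) (s := s) (t := t) (t' := 0) D eE; rewrite gt (turn0 pos pl len e b s) => h.
  by have := h ltac:(lra) erefl; lra.
have gN := N2 g gE ge (esym gend); have [G2 [Gr _]] := HF g gN.
have := fmin g; rewrite mem_enum => /(_ gN) le.
have : t = F g; last by lra.
by apply: (turn_inj (b := b) (s := s) D eE); [lra|rewrite gt Gr].
Qed.

Lemma side_turn e b s tau : e \in E -> (2 <= degree E (end_of e b))%N ->
  0 < tau -> (forall f t, f \in E -> 0 < t <= tau -> small_turn f b t) ->
  exists f, [/\ f \in E, f != e, end_of f b = end_of e b &
    {in cycles E, forall z, winding z (turn_pt f b (~~ s) tau) = winding z (turn_pt e b s tau)}].
Proof.
move=> eE deg t0 sm; have [f [th [fE fe fend [th0 [thf free]]]]] := next_edge s eE deg.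
exists f; split=> // z zc; rewrite -thf.
have /cyclesP[/subsetP zE _] := zc.
(* Otherwise the midpoint of the radius of [f] would lie in the neighbourhood where only [e] is
   met. *)
have tth : tau < th.
  apply: Rnot_le_lt => le.
  have [h _] : near_only_radial e b (turn_pt e b s th).
    apply: (proj2 (sm e th eE (conj th0 le)) s s); right; exists 0; first lra.
    by rewrite /lerp; case: (turn_pt _ _ _ _) => x y /=; congr pair; ring.
  apply: (h f fE fe); have := thf 0; rewrite Rminus_0_r turn0 => ->.
  by apply: (radial_on_edge D) => //; lra.
(* Both angles lie strictly between 0 and [th], but their order is unknown. *)
case: (Rle_lt_dec tau (th - tau)) => le.
  symmetry; apply: (winding_path D zc le).
  - exact: turn_cont1.
  - exact: turn_cont2.
  by move=> t g tb gz; apply: free; [lra|exact: zE].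
apply: (winding_path D zc (Rlt_le _ _ le)).
- exact: turn_cont1.
- exact: turn_cont2.
by move=> t g tb gz; apply: free; [lra|exact: zE].
Qed.

(** The functionals for [bipartite_euler] are read off at the [false] end of each edge, and
    [match_ends] carries them to and from the end at which the face turns. *)
Lemma drawing_core S : spans S E -> E != set0 ->
  (forall v, v \in S -> (2 <= degree E v)%N) -> (#|E| + 4 <= 2 * #|S|)%N.
Proof.
move=> ES E0 deg.
have [||tau t0 Ht] := @finite_pos ((A * B) * bool)%type
  (fun p d => p.1 \in E -> forall t, 0 < t <= d -> small_turn p.1 p.2 t).
- by move=> [e b] d d' dd' H eE t t0; apply: H => //; lra.
- move=> [e b]; case: (boolP (e \in E)) => eE; last first.
    by exists 1; [lra|move=> /= h; case/negP: eE].
  by have [tau t0 H] := small_turn_exists b eE; exists tau.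
have sm e b : e \in E -> small_turn e b tau by move=> eE; apply: (Ht (e, b)) => //=; lra.
pose psi e b s z := winding z (turn_pt e b s tau).
have add e b s z z' : psi e b s (symdiff z z') = psi e b s z (+) psi e b s z'.
  exact: xsum_symdiff.
have jump e b z : e \in E -> z \in cycles E ->
    psi e b false z (+) psi e b true z = (e \in z).
  by move=> eE; apply: side_jump => //; apply: sm.
have base e b s z : e \in E -> z \in cycles E -> e \notin z ->
    psi e b s z = winding z (radial e false (1/2)).
  move=> eE zc nez; rewrite /psi side_base //; last exact: sm.
  by case: b => //; rewrite -along_edge.
(* One cycle [z0] through [e] fixes the correspondence of sides. For any other cycle through [e],
   its sum with [z0] avoids [e], and [base] applies. *)
have match_ends e b c s : e \in E ->
    exists s', {in cycles E, forall z, psi e c s' z = psi e b s z}.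
  move=> eE.
  have [/existsP[z0 /andP[z0c ez0]]|] := boolP [exists z, (z \in cycles E) && (e \in z)].
    have [s' Hs'] : exists s', psi e c s' z0 = psi e b s z0.
      have := jump e c z0 eE z0c; rewrite ez0.
      case h1: (psi e c false z0); case h2: (psi e c true z0) => //= _;
      by case: (psi e b s z0); [(by exists false)||(by exists true)|(by exists true)||(by exists false)].
    exists s' => z zc; have [ez|nez] := boolP (e \in z); last by rewrite !base.
    have nsd : e \notin symdiff z z0 by rewrite inE ez ez0.
    have sdc := cycles_symdiff zc z0c.
    have := base e c s' _ eE sdc nsd; rewrite -(base e b s _ eE sdc nsd) !add Hs'.
    exact: addIb.
  rewrite negb_exists => /forallP none; exists s => z zc.
  have nez : e \notin z by have := none z; rewrite zc.
  by rewrite !base.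
apply: (@bipartite_euler _ _ E S (fun e s => psi e false s)) => //.
- by move=> e z eE zc; apply: jump.
move=> e s b eE.
have [s1 H1] := match_ends e false b s eE.
have [|f [fE fe fend Hf]] := @side_turn e b s1 tau eE (deg _ (ES e eE b)) t0.
  by move=> f t fE; apply: (Ht (f, b)).
have [s2 H2] := match_ends f b false (~~ s1) fE.
exists f, s2; split=> // z zc.
by rewrite H2 // /psi Hf // -/(psi e b s1 z) H1.
Qed.

End Drawing2.

Lemma drawing_bound (A B : finType) pos pl len r (E : {set A * B}) (S : {set A + B}) :
  drawing pos pl len r E -> spans S E -> (3 <= #|S|)%N -> (#|E| + 4 <= 2 * #|S|)%N.
Proof.
apply: (delete_low_degree (Good := drawing pos pl len r)).
- by move=> F1 F2; apply: drawing_sub.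
by move=> F S' dF FS F0 deg; apply: (drawing_core dF).
Qed.

(** * Polygonal approximation of arcs *)

Lemma choice_fun (X Y : Type) (P : X -> Y -> Prop) :
  (forall x, exists y, P x y) -> exists f, forall x, P x (f x).
Proof.
move=> ex; exists (fun x => proj1_sig (constructive_indefinite_description _ (ex x))) => x.
exact: (proj2_sig (constructive_indefinite_description _ (ex x))).
Qed.

Lemma last_exit (h : R -> R) a b c : continuity h -> a < b -> h a < c -> c < h b ->
  exists2 t, a < t < b & h t = c /\ forall t', t < t' <= b -> c < h t'.
Proof.
move=> ch ab ha hb.
pose S t := a <= t <= b /\ h t <= c.
have Sa : S a by rewrite /S; lra.
have [m [ub lub]] : {m | is_lub S m}.
  by apply: completeness; [exists b => t []; lra | exists a].
have am : a <= m by exact: ub.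
have mb : m <= b by apply: lub => t []; lra.
have loc eps : 0 < eps -> exists2 d, 0 < d & forall t, Rabs (t - m) < d -> Rabs (h t - h m) < eps.
  move=> e0; have [d [d0 Hd]] := ch m eps e0; exists d => // t tm.
  case: (Req_dec m t) => [<-|ne]; first by rewrite Rminus_diag Rabs_R0.
  by apply: (Hd t); split; [split|exact: tm].
have hm1 : h m <= c.
  apply: Rnot_lt_le => lt.
  have [|d d0 Hd] := loc (h m - c); first by lra.
  have : m <= m - d; last by lra.
  apply: lub => t [tab ht]; apply: Rnot_lt_le => tm.
  have tm' := ub t (conj tab ht).
  by have := Rabs_def2 _ _ (Hd t ltac:(apply: Rabs_def1; lra)); lra.
have hm2 : c <= h m.
  apply: Rnot_lt_le => lt.
  have [|d d0 Hd] := loc (c - h m); first by lra.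
  have mb' : m < b by case: (Req_dec m b) => [eq|]; [rewrite eq in lt; lra|lra].
  have := Rmin_l (d / 2) (b - m); have := Rmin_r (d / 2) (b - m) => r1 r2.
  have r3 : 0 < Rmin (d / 2) (b - m) by apply: Rmin_pos; lra.
  have : S (m + Rmin (d / 2) (b - m)).
    split; first by lra.
    by have := Rabs_def2 _ _ (Hd (m + Rmin (d / 2) (b - m)) ltac:(apply: Rabs_def1; lra)); lra.
  by move/ub; lra.
have hm : h m = c by lra.
exists m.
  by split; apply: Rnot_le_lt => le; [have eq : m = a by lra|have eq : m = b by lra]; rewrite eq in hm; lra.
split=> // t' tm; apply: Rnot_le_lt => le.
by have : t' <= m; [apply: ub; rewrite /S; lra|lra].
Qed.

Lemma first_entry (h : R -> R) a b c : continuity h -> a < b -> c < h a -> h b < c ->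
  exists2 t, a < t < b & h t = c /\ forall t', a <= t' < t -> c < h t'.
Proof.
move=> ch ab ha hb.
have cr : continuity (fun t => h (a + b - t)).
  apply: (continuity_comp (fun t => a + b - t) h) => //; reg.
have [||t tab [ht tl]] := last_exit (h := fun t => h (a + b - t)) (c := c) cr ab.
- by have -> : a + b - a = b by ring.
- by have -> : a + b - b = a by ring.
exists (a + b - t); first by lra.
split=> // t' t'b; have := tl (a + b - t') ltac:(lra).
by have -> : a + b - (a + b - t') = t' by ring.
Qed.

Lemma near_le d d' x y : d <= d' -> near d x y -> near d' x y.
Proof. by move=> dd' [n1 n2]; split; lra. Qed.

Lemma near_sym d x y : near d x y -> near d y x.
Proof. by case=> n1 n2; split; rewrite Rabs_minus_sym. Qed.

Lemma near_trans d d' x y w : near d x y -> near d' y w -> near (d + d') x w.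
Proof.
move=> [] /Rabs_def2 h1 /Rabs_def2 h2 [] /Rabs_def2 h3 /Rabs_def2 h4.
by split; apply: Rabs_def1; lra.
Qed.

Lemma near_dist2 d x y : 0 < d -> dist2 x y < d * d -> near d x y.
Proof.
move=> d0; rewrite /dist2 /near; move: (x.1 - y.1) (x.2 - y.2) => u v h.
have hu : u * u < d * d by nra.
have hv : v * v < d * d by nra.
by split; apply: Rabs_def1; nra.
Qed.

(** If [y] were within [d] of [w], both coordinates of [x - w] would be at most 5/4 [d], and 2
    (25/16) < 4. *)
Lemma near_far d x y w : 0 < d -> 4 * (d * d) <= dist2 x w -> near (d / 4) x y ->
  d * d < dist2 y w.
Proof.
move=> d0 far [] /Rabs_def2 n1 /Rabs_def2 n2; apply: Rnot_le_lt => le.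
have [k1 k2] : (-d <= y.1 - w.1 <= d) /\ (-d <= y.2 - w.2 <= d).
  move: le; rewrite /dist2; move: (y.1 - w.1) (y.2 - w.2) => u v le.
  have hu : u * u <= d * d by nra.
  have hv : v * v <= d * d by nra.
  by split; split; nra.
have : dist2 x w < 4 * (d * d); last by lra.
have l1 : (x.1 - w.1) * (x.1 - w.1) <= (5 / 4 * d) * (5 / 4 * d) by nra.
have l2 : (x.2 - w.2) * (x.2 - w.2) <= (5 / 4 * d) * (5 / 4 * d) by nra.
rewrite /dist2; nra.
Qed.

Section Arcs.
Variables A B : finType.
Variables (pos : A + B -> pt) (gx gy : A * B -> R -> R) (E : {set A * B}).
Local Notation g e t := ((gx e t, gy e t) : pt).
Hypothesis pos_inj : injective pos.
Hypothesis gx_cont : forall e, e \in E -> continuity (gx e).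
Hypothesis gy_cont : forall e, e \in E -> continuity (gy e).
Hypothesis g_src : forall e, e \in E -> g e 0 = pos (end_of e false).
Hypothesis g_tgt : forall e, e \in E -> g e 1 = pos (end_of e true).
Hypothesis g_avoid : forall e t v, e \in E -> 0 < t < 1 -> g e t <> pos v.
Hypothesis g_disj : forall e f s t, e \in E -> f \in E -> e != f ->
  0 < s < 1 -> 0 < t < 1 -> g e s <> g f t.

Lemma dist_cont e v : e \in E -> continuity (fun t => dist2 (g e t) (pos v)).
Proof.
move=> eE; rewrite /dist2 /=.
have c1 : continuity (fun t => gx e t - (pos v).1).
  by apply: continuity_minus; [exact: gx_cont|reg].
have c2 : continuity (fun t => gy e t - (pos v).2).
  by apply: continuity_minus; [exact: gy_cont|reg].
by apply: continuity_plus; apply: continuity_mult.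
Qed.

Lemma radius_exists : exists r, [/\ 0 < r,
  forall u v, u != v -> 16 * (r * r) < dist2 (pos u) (pos v) &
  forall e v t, e \in E -> (forall b, v != end_of e b) -> 0 <= t <= 1 ->
    4 * (r * r) < dist2 (g e t) (pos v)].
Proof.
have [||r1 r10 H1] := @finite_pos ((A + B) * (A + B))%type
  (fun p d => p.1 != p.2 -> 16 * (d * d) < dist2 (pos p.1) (pos p.2)).
- by move=> p d d' dd' H ne; have := H ne; nra.
- move=> [u v] /=; have [->|ne] := eqVneq u v; first by exists 1; [lra|].
  set D2 := dist2 _ _.
  have D0 : 0 < D2.
    have : D2 <> 0.
      rewrite /D2 /dist2 => h; case/eqP: ne; apply: pos_inj.
      case: (pos u) (pos v) h => u1 u2 [v1 v2] /= h.
      have := Rle_0_sqr (u1 - v1); have := Rle_0_sqr (u2 - v2); rewrite /Rsqr => h2 h1.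
      have /Rmult_integral z1 : (u1 - v1) * (u1 - v1) = 0 by lra.
      have /Rmult_integral z2 : (u2 - v2) * (u2 - v2) = 0 by lra.
      by congr pair; lra.
    have : 0 <= D2; last by lra.
    have := Rle_0_sqr ((pos u).1 - (pos v).1); have := Rle_0_sqr ((pos u).2 - (pos v).2).
    by rewrite /D2 /dist2 /Rsqr; lra.
  exists (sqrt D2 / 5); first by have := sqrt_lt_R0 _ D0; lra.
  by move=> _; have := sqrt_sqrt D2 (Rlt_le _ _ D0); nra.
have [||r2 r20 H2] := @finite_pos ((A * B) * (A + B))%type
  (fun p d => p.1 \in E -> (forall b, p.2 != end_of p.1 b) -> forall t, 0 <= t <= 1 ->
     4 * (d * d) < dist2 (g p.1 t) (pos p.2)).
- by move=> p d d' dd' H pE ne t t01; have := H pE ne t t01; nra.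
- move=> [e v] /=; case: (boolP (e \in E)) => eE; last by exists 1; [lra|].
  case: (boolP [forall b, v != end_of e b]) => [/forallP ne|/forallP ne]; last first.
    by exists 1; [lra|move=> _ h; case: ne].
  have cc : forall u s, continuity_pt (fun _ : R => u) s by move=> u s; reg.
  have [s t s01 _ e1 e2|d d0 Hd] := separated (s0:=0) (s1:=1) (t0:=0) (t1:=1) (gx_cont eE) (gy_cont eE) (cc (pos v).1) (cc (pos v).2).
    have ev : g e s = pos v by rewrite e1 e2; case: (pos v).
    case: (Req_dec s 0) => [h|h0].
      by rewrite h (g_src eE) in ev; move/pos_inj: ev => h'; case/eqP: (ne false).
    case: (Req_dec s 1) => [h|h1].
      by rewrite h (g_tgt eE) in ev; move/pos_inj: ev => h'; case/eqP: (ne true).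
    by apply: (g_avoid (v := v) eE _ ev); lra.
  exists (d / 3); first by lra.
  move=> _ _ t t01; apply: Rnot_le_lt => le; apply: (Hd t 0) => //; first by lra.
  by have := @near_dist2 d (g e t) (pos v) d0; case: (pos v) le => v1 v2 le; apply; nra.
exists (Rmin r1 r2); have := Rmin_pos _ _ r10 r20; have := Rmin_l r1 r2; have := Rmin_r r1 r2.
move=> m2 m1 m0; split=> //.
  by move=> u v ne; have := H1 (u, v) ne => /=; nra.
by move=> e v t eE ne t01; have := H2 (e, v) eE ne t t01 => /=; nra.
Qed.

Section Radius.
Variable r : R.
Hypothesis r0 : 0 < r.
Hypothesis far : forall u v, u != v -> 16 * (r * r) < dist2 (pos u) (pos v).
Hypothesis arc_far : forall e v t, e \in E -> (forall b, v != end_of e b) -> 0 <= t <= 1 ->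
    4 * (r * r) < dist2 (g e t) (pos v).

Lemma truncate e : e \in E -> exists T : bool -> R,
  [/\ 0 < T false, T false < T true, T true < 1,
   (forall b, dist2 (g e (T b)) (pos (end_of e b)) = 4 * (r * r)) &
   forall b t, T false <= t <= T true -> t <> T b ->
     4 * (r * r) < dist2 (g e t) (pos (end_of e b))].
Proof.
move=> eE; have rr : 0 < r * r by nra.
have ne : end_of e false != end_of e true by [].
have ff := far ne.
have z0 u : dist2 (pos u) (pos u) = 0 by rewrite /dist2; ring.
have [||t0 t01 [ht0 t0l]] := last_exit (c := 4 * (r * r)) (dist_cont (end_of e false) eE) Rlt_0_1.
- by rewrite g_src // z0; lra.
- by rewrite g_tgt // dist2_sym; lra.
have [||t1 t11 [ht1 t1l]] := first_entry (c := 4 * (r * r)) (dist_cont (end_of e true) eE) (proj2 t01).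
- have := dist2_triangle (pos (end_of e false)) (g e t0) (pos (end_of e true)).
  by rewrite [dist2 _ (g e t0)]dist2_sym ht0; lra.
- by rewrite g_tgt // z0; lra.
exists (fun b => if b then t1 else t0); split=> //=; try lra.
  by case.
by case=> t tt nt; [apply: t1l|apply: t0l]; lra.
Qed.

Variable T : A * B -> bool -> R.
Hypothesis T_ends : forall e, e \in E ->
  [/\ 0 < T e false, T e false < T e true & T e true < 1].
Hypothesis T_dist : forall e b, e \in E ->
  dist2 (g e (T e b)) (pos (end_of e b)) = 4 * (r * r).
Hypothesis T_far : forall e b t, e \in E -> T e false <= t <= T e true -> t <> T e b ->
  4 * (r * r) < dist2 (g e t) (pos (end_of e b)).

(** The straight radius of [f] stays within [2 r] of its vertex, and the truncated arc of [e]
    outside that disc except possibly for its own exit point. They could only share both exit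
    points, where the arcs are disjoint. *)
Lemma truncated_disjoint e f b s u : e \in E -> f \in E -> e != f ->
  T e false <= s <= T e true -> 0 <= u <= 1 ->
  g e s <> lerp (pos (end_of f b)) (g f (T f b)) u.
Proof.
move=> eE fE ef st u01 eq; have rr : 0 < r * r by nra.
have [e0 e1 e2] := T_ends eE; have [f0 f1 f2] := T_ends fE.
have fT : 0 < T f b < 1 by case: (b); lra.
have d1 : dist2 (g e s) (pos (end_of f b)) = u * u * (4 * (r * r)).
  by rewrite eq -(T_dist b fE) /dist2 /lerp /=; ring.
have uu : u * u <= 1 by nra.
case: (boolP [forall c, end_of f b != end_of e c]) => [/forallP ne|].
  by have := arc_far eE ne (t := s) ltac:(lra); nra.
rewrite negb_forall => /existsP[c]; rewrite negbK => /eqP ends.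
have bc := ends_eq ends; subst c.
case: (Req_dec s (T e b)) => [sT|nsT]; last first.
  by have := T_far (b := b) eE st nsT; rewrite -ends d1; nra.
have := T_dist b eE; rewrite -ends -sT d1 => h.
have u1 : u = 1 by have : u * u = 1 by [apply: (Rmult_eq_reg_r (4 * (r * r))); lra]; nra.
apply: (g_disj eE fE ef (s := s) (t := T f b)) => //; first by lra.
by rewrite eq u1 /lerp; congr pair => /=; ring.
Qed.

Lemma truncated_sep : exists2 d, 0 < d & forall e f s, e \in E -> f \in E -> e != f ->
  T e false <= s <= T e true ->
  (forall t, T f false <= t <= T f true -> ~ near (2 * d) (g e s) (g f t)) /\
  (forall b u, 0 <= u <= 1 -> ~ near d (g e s) (lerp (pos (end_of f b)) (g f (T f b)) u)).
Proof.
have [||d1 d10 H1] := @finite_pos ((A * B) * (A * B))%type (fun p d =>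
  p.1 \in E -> p.2 \in E -> p.1 != p.2 -> forall s t,
  T p.1 false <= s <= T p.1 true -> T p.2 false <= t <= T p.2 true ->
  ~ near (2 * d) (g p.1 s) (g p.2 t)).
- move=> p d d' dd' H h1 h2 h3 s t hs ht [n1 n2]; apply: (H h1 h2 h3 s t hs ht).
  by split; lra.
- move=> [e f] /=; case: (boolP [&& e \in E, f \in E & e != f]) => [/and3P[eE fE ef]|nh]; last first.
    by exists 1; [lra|move=> h1 h2 h3; case/negP: nh; rewrite h1 h2].
  have [e0 e1 e2] := T_ends eE; have [f0 f1 f2] := T_ends fE.
  have [s t hs ht x1 x2|d d0 Hd] := separated (s0 := T e false) (s1 := T e true) (t0 := T f false)
    (t1 := T f true) (gx_cont eE) (gy_cont eE) (gx_cont fE) (gy_cont fE).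
    by apply: (g_disj eE fE ef (s := s) (t := t)); [lra|lra|rewrite x1 x2].
  exists (d / 2); first by lra.
  move=> _ _ _ s t hs ht; have -> : 2 * (d / 2) = d by field.
  exact: Hd.
have [||d2 d20 H2] := @finite_pos ((A * B) * (A * B) * bool)%type (fun p d =>
  p.1.1 \in E -> p.1.2 \in E -> p.1.1 != p.1.2 -> forall s u,
  T p.1.1 false <= s <= T p.1.1 true -> 0 <= u <= 1 ->
  ~ near d (g p.1.1 s) (lerp (pos (end_of p.1.2 p.2)) (g p.1.2 (T p.1.2 p.2)) u)).
- move=> p d d' dd' H h1 h2 h3 s t hs ht [n1 n2]; apply: (H h1 h2 h3 s t hs ht).
  by split; lra.
- move=> [[e f] b] /=; case: (boolP [&& e \in E, f \in E & e != f]) => [/and3P[eE fE ef]|nh]; last first.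
    by exists 1; [lra|move=> h1 h2 h3; case/negP: nh; rewrite h1 h2].
  have cl : forall x y s, continuity_pt (fun t => x + t * (y - x)) s by move=> x y s; reg.
  have [s t hs ht x1 x2|d d0 Hd] := separated (s0 := T e false) (s1 := T e true) (t0 := 0)
    (t1 := 1) (gx_cont eE) (gy_cont eE) (cl (pos (end_of f b)).1 (gx f (T f b)))
    (cl (pos (end_of f b)).2 (gy f (T f b))).
    by apply: (truncated_disjoint (b := b) eE fE ef hs ht); rewrite x1 x2.
  by exists d => // _ _ _ s u; apply: Hd.
exists (Rmin d1 d2); first exact: Rmin_pos.
have := Rmin_l d1 d2; have := Rmin_r d1 d2 => m2 m1 e f s eE fE ef hs; split.
  move=> t ht nr; apply: (H1 (e, f) eE fE ef s t hs ht).
  by apply: near_le nr; lra.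
move=> b u hu nr; apply: (H2 (e, f, b) eE fE ef s u hs hu).
by apply: near_le nr.
Qed.

Definition grid (a b : R) (m i : nat) : R := a + INR i / INR m * (b - a).

Lemma subdivide e d : e \in E -> 0 < d -> exists m, (0 < m)%N /\
  forall i, (i < m)%N ->
  near d (g e (grid (T e false) (T e true) m i)) (g e (grid (T e false) (T e true) m i.+1)).
Proof.
move=> eE d0; have [e0 e1 e2] := T_ends eE; set a := T e false; set b := T e true.
have cx : forall x, a <= x <= b -> continuity_pt (gx e) x by move=> x _; exact: gx_cont.
have cy : forall x, a <= x <= b -> continuity_pt (gy e) x by move=> x _; exact: gy_cont.
have [d1 H1] := Heine_cor2 cx (mkposreal d d0).
have [d2 H2] := Heine_cor2 cy (mkposreal d d0).
have m0 : 0 < Rmin d1 d2 by apply: Rmin_pos; apply: cond_pos.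
have [m [hm mp]] := archimed_cor1 (Rmin d1 d2) m0.
have Im : 0 < INR m by apply: lt_0_INR.
exists m; split; first by apply/ltP.
move=> i im; have Ii := pos_INR i.
have iM : INR i + 1 <= INR m by rewrite -S_INR; apply: le_INR; apply/leP.
have rng x : 0 <= x <= INR m -> a <= a + x / INR m * (b - a) <= b.
  move=> xm; have : 0 <= x / INR m <= 1; last by rewrite /a /b; nra.
  split; first by apply: Rmult_le_pos; [lra|apply: Rlt_le; apply: Rinv_0_lt_compat].
  by apply: (Rmult_le_reg_r (INR m)) => //; rewrite /Rdiv Rmult_assoc Rinv_l; lra.
have stp : Rabs (grid a b m i - grid a b m i.+1) < Rmin d1 d2.
  rewrite /grid S_INR Rabs_minus_sym.
  have -> : a + (INR i + 1) / INR m * (b - a) - (a + INR i / INR m * (b - a)) = / INR m * (b - a) by field; lra.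
  have iv := Rinv_0_lt_compat _ Im.
  by rewrite Rabs_pos_eq; rewrite /a /b; nra.
have := Rmin_l d1 d2; have := Rmin_r d1 d2 => m2 m1.
split; [apply: H1|apply: H2]; try lra.
all: rewrite /grid ?S_INR; apply: rng; lra.
Qed.

Lemma polygonalize : exists pl len, drawing pos pl len r E.
Proof.
have rr : 0 < r * r by nra.
have [d1 d10 sep1] := truncated_sep.
(* The bound [d1] keeps the polygons of distinct edges apart, and [r / 4] serves [near_far]. *)
set d := Rmin d1 (r / 4).
have d0 : 0 < d by apply: Rmin_pos; lra.
have := Rmin_l d1 (r / 4); have := Rmin_r d1 (r / 4); rewrite -/d => dr dd1.
have [|M HM] := @choice_fun (A * B)%type nat (fun e m => e \in E -> (0 < m)%N /\
  forall i, (i < m)%N ->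
  near d (g e (grid (T e false) (T e true) m i)) (g e (grid (T e false) (T e true) m i.+1))).
  move=> e; case: (boolP (e \in E)) => eE; last by exists 0%N.
  by have [m hm] := subdivide eE d0; exists m.
pose gr e i := g e (grid (T e false) (T e true) (M e) i).
(* The polygon consists of the source, the [M e + 1] grid points on the truncated arc and the
   target, hence [M e + 2] segments. *)
pose pl e i := if i is j.+1 then if (j <= M e)%N then gr e j else pos (end_of e true)
               else pos (end_of e false).
pose len e := (M e).+2.
have gr0 e : gr e 0%N = g e (T e false).
  by rewrite /gr /grid /= /Rdiv !Rmult_0_l Rplus_0_r.
have grM e : e \in E -> gr e (M e) = g e (T e true).
  move=> eE; have [Mp _] := HM e eE; rewrite /gr /grid.
  have Mn : INR (M e) <> 0 by apply: not_0_INR; lia.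
  by have -> : T e false + INR (M e) / INR (M e) * (T e true - T e false) = T e true by field.
have plS e j : (j <= M e)%N -> pl e j.+1 = gr e j by rewrite /pl => ->.
have pllen e : pl e (M e).+2 = pos (end_of e true) by rewrite /pl ltnn.
have exitE e b : e \in E -> exit_pt pl len e b = g e (T e b).
  move=> eE; case: b; rewrite /exit_pt; last by rewrite plS // gr0.
  by rewrite -[(len e).-1]/((M e).+1) plS // grM.
have grT e i : e \in E -> (i <= M e)%N ->
    T e false <= grid (T e false) (T e true) (M e) i <= T e true.
  move=> eE iM; have [Mp _] := HM e eE; have [e0 e1 e2] := T_ends eE.
  have Im : 0 < INR (M e) by apply: lt_0_INR; apply/ltP.
  have iM' : INR i <= INR (M e) by apply: le_INR; apply/leP.
  have Ii := pos_INR i; rewrite /grid.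
  have : 0 <= INR i / INR (M e) <= 1; last by nra.
  split; first by apply: Rmult_le_pos; [lra|apply: Rlt_le; apply: Rinv_0_lt_compat].
  by apply: (Rmult_le_reg_r (INR (M e))) => //; rewrite /Rdiv Rmult_assoc Rinv_l; lra.
have midP e i x : e \in E -> mid len e i -> on_seg (pl e i) (pl e i.+1) x ->
    exists2 s, T e false <= s <= T e true & near d (g e s) x.
  move=> eE; case: i => // j jm; have jM : (j < M e)%N by move: jm; rewrite /mid /len; lia.
  rewrite !plS //; last exact: ltnW.
  move=> xs; exists (grid (T e false) (T e true) (M e) j); first by apply: grT => //; lia.
  by apply: near_seg xs => //; apply: (proj2 (HM e eE)); lia.
have arc_dist e s v : e \in E -> T e false <= s <= T e true -> 4 * (r * r) <= dist2 (g e s) (pos v).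
  move=> eE sT; have [e0 e1 e2] := T_ends eE.
  case: (boolP [forall c, v != end_of e c]) => [/forallP ne|].
    by apply: Rlt_le; apply: arc_far => //; lra.
  rewrite negb_forall => /existsP[c]; rewrite negbK => /eqP ->.
  case: (Req_dec s (T e c)) => [->|nsT]; first by rewrite T_dist //; lra.
  by apply: Rlt_le; apply: T_far.
exists pl, len; split=> //.
- by move=> e eE; have [Mp _] := HM e eE; rewrite /len; lia.
- by move=> e b eE; rewrite exitE // T_dist.
- move=> e i x v eE im xs; have [s sT ns] := midP e i x eE im xs.
  apply: (@near_far r (g e s)) => //; first exact: arc_dist.
  by apply: near_le ns; lra.
- move=> e f i x eE fE ef im xs [j jl xf]; have [s sT ns] := midP e i x eE im xs.
  have [sepA sepR] := sep1 e f s eE fE ef sT.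
  have near1 : near d1 (g e s) x by apply: near_le ns; lra.
  (* The segment of [f] is the first radius, a middle segment (within [d] of the arc, whence the
     factor 2 in [truncated_sep]) or the last radius. *)
  case: (posnP j) => [j0|j0].
    subst j; case: xf => t t01 xE; apply: (sepR false t t01).
    by rewrite xE /= gr0 in near1.
  case: (ltnP j (M f).+1) => jM.
    have [|t tT nt] := midP f j x fE _ xf; first by rewrite /mid /len /=; lia.
    apply: (sepA t tT); have -> : 2 * d1 = d1 + d1 by ring.
    by apply: near_trans near1 (near_sym _); apply: near_le nt; lra.
  have jE : j = (M f).+1 by move: jl; rewrite /len; lia.
  subst j; case: xf => t t01 xE; apply: (sepR true (1 - t) ltac:(lra)).
  have <- : x = lerp (pos (end_of f true)) (g f (T f true)) (1 - t); last by [].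
  rewrite xE pllen plS // grM // /lerp; congr pair => /=; ring.
move=> e f b eE fE ef ends; rewrite !exitE //.
have [e0 e1 e2] := T_ends eE; have [f0 f1 f2] := T_ends fE.
by apply: g_disj => //; case: b {ends}; lra.
Qed.

End Radius.

Lemma arcs_drawing : exists pl len r, drawing pos pl len r E.
Proof.
have [r [r0 far arc_far]] := radius_exists.
have [|T HT] := @choice_fun (A * B)%type (bool -> R) (fun e T => e \in E ->
  [/\ 0 < T false, T false < T true, T true < 1,
   (forall b, dist2 (g e (T b)) (pos (end_of e b)) = 4 * (r * r)) &
   forall b t, T false <= t <= T true -> t <> T b ->
     4 * (r * r) < dist2 (g e t) (pos (end_of e b))]).
  move=> e; case: (boolP (e \in E)) => eE; last by exists (fun=> 0).
  by have [T HT] := truncate r0 far eE; exists T.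
have [|||pl [len dr]] := @polygonalize r r0 far arc_far T; last by exists pl, len, r.
- by move=> e /HT[h1 h2 h3 _ _]; split.
- by move=> e b /HT[_ _ _ h _]; apply: h.
by move=> e b t /HT[_ _ _ _ h]; apply: h.
Qed.

End Arcs.

Lemma planar_bipartite_bound (T : finType) (H : rel (T * bool)) :
  planar H -> (2 <= #|T|)%N ->
  (#|[set p : T * T | H (p.1, false) (p.2, true)]| + 4 <= 4 * #|T|)%N.
Proof.
move=> [px [py [cx [cy [inj [arc disj]]]]]] T2.
set E := [set p : T * T | _].
pose vtx (v : T + T) : T * bool := match v with inl x => (x, false) | inr y => (y, true) end.
pose pos v : pt := (px (vtx v), py (vtx v)).
pose gx (e : T * T) := cx (e.1, false) (e.2, true).
pose gy (e : T * T) := cy (e.1, false) (e.2, true).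
have EP e : e \in E -> H (e.1, false) (e.2, true) by rewrite inE.
have [|||||||pl [len [r dr]]] := @arcs_drawing T T pos gx gy E.
- by move=> u v [e1 e2]; have := inj _ _ e1 e2; case: u {e1 e2} => x; case: v => y //= [->].
- by move=> e /EP/arc[].
- by move=> e /EP/arc[_ []].
- by move=> e /EP/arc[_ [_ [h1 [h2 _]]]]; rewrite /gx /gy h1 h2.
- by move=> e /EP/arc[_ [_ [_ [_ [h1 [h2 _]]]]]]; rewrite /gx /gy h1 h2.
- move=> e t v /EP/arc[_ [_ [_ [_ [_ [_ [_ h]]]]]]] t01 [e1 e2].
  exact: (h t (vtx v) t01).
- move=> [e1 e2] [f1 f2] s t /EP eE /EP fE ef s01 t01 [x1 x2].
  apply: (disj _ _ _ _ eE fE _ s t s01 t01); last by split.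
  (* Both edges run from colour [false] to colour [true], so neither is the reverse of the other. *)
  by move=> [[[h1] [h2]]|[[]]] //; case/eqP: ef; rewrite h1 h2.
have cT : #|[set: T + T]| = (2 * #|T|)%N by rewrite cardsT card_sum; lia.
have := drawing_bound (S := setT) dr; rewrite cT; move/(_ (fun e _ b => in_setT _)).
rewrite mulnA => h; apply: h; exact: (@leq_trans 4) (leq_mul (leqnn 2) T2).
Qed.

(** * Straight-line drawings of the layers *)

Inductive quad := Q0 | Q1 | Q2 | Q3.
Definition next_quad q := match q with Q0 => Q1 | Q1 => Q2 | Q2 => Q3 | Q3 => Q0 end.
Definition turn_quad q (x : pt) : pt :=
  match q with Q0 => x | Q1 => (- x.2, x.1) | Q2 => (- x.1, - x.2) | Q3 => (x.2, - x.1) end.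
Definition unturn_quad q (x : pt) : pt :=
  match q with Q0 => x | Q1 => (x.2, - x.1) | Q2 => (- x.1, - x.2) | Q3 => (- x.2, x.1) end.

(** Corners of the outer square, corners of the inner square, and points on the diagonal from
    [Inn q] to [Out (next_quad q)] of a trapezoid. *)
Inductive place := Out of quad | Inn of quad | Dia of quad & nat.
Definition frac (i : nat) : R := / (INR i + 2).
Definition coord (p : place) : pt :=
  match p with
  | Out q => turn_quad q (3, 0)
  | Inn q => turn_quad q (1, 0)
  | Dia q i => turn_quad q (frac i, 3 - 3 * frac i)
  end.

(** Up to rotation: spokes, sides of the squares, and the two open triangles cut from a trapezoid by
    its diagonal. These pieces are pairwise disjoint, so segments can cross only inside one
    piece. *)
Inductive cell := Spoke | Outer | Inner | FanO | FanI.
Definition region c q (x : pt) : Prop :=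
  let: (a, b) := unturn_quad q x in
  match c with
  | Spoke => b = 0 /\ 1 < a < 3
  | Outer => 0 < a /\ 0 < b /\ a + b = 3
  | Inner => 0 < a /\ 0 < b /\ a + b = 1
  | FanO => 0 < a /\ 0 < b /\ 1 < a + b < 3 /\ 3 < 3 * a + b
  | FanI => 0 < a /\ 0 < b /\ 1 < a + b < 3 /\ 3 * a + b < 3
  end.

Inductive seg : place -> place -> cell -> quad -> Prop :=
  | SegSpoke q : seg (Out q) (Inn q) Spoke q
  | SegOuter q : seg (Out q) (Out (next_quad q)) Outer q
  | SegInner q : seg (Inn q) (Inn (next_quad q)) Inner q
  | SegFanO q i : seg (Out q) (Dia q i) FanO q
  | SegFanI q i : seg (Inn (next_quad q)) (Dia q i) FanI q.

Lemma frac01 i : 0 < frac i < 1.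
Proof.
have := pos_INR i => h; rewrite /frac; split; first by apply: Rinv_0_lt_compat; lra.
by rewrite -Rinv_1; apply: Rinv_lt_contravar; lra.
Qed.

Lemma frac_inj i j : frac i = frac j -> i = j.
Proof.
rewrite /frac => /(f_equal Rinv); rewrite !Rinv_inv => h.
by apply: INR_eq; lra.
Qed.

Lemma seg_region p p' c q t : seg p p' c q -> 0 < t < 1 ->
  region c q (lerp (coord p) (coord p') t).
Proof.
case=> {}q; rewrite /region /coord.
1-3: by move=> t01; case: q; rewrite /lerp /=; lra.
all: move=> i; have := frac01 i; move: (frac i) => s s01 t01.
all: have ts : 0 < t * s by nra.
all: have ts1 : t * s < t by nra.
all: have ts2 : t * s < s by nra.
all: have ts3 : 0 < (1 - t) * (1 - s) by nra.
all: by case: q; rewrite /lerp /=; repeat split; lra.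
Qed.

(** Fan segments in one triangle leave a common corner for the diagonal. A linear form constant on
    the diagonal gives [t = t'], and then the end points agree. *)
Lemma seg_inj p p' r r' c q t t' : seg p p' c q -> seg r r' c q -> 0 < t -> 0 < t' ->
  lerp (coord p) (coord p') t = lerp (coord r) (coord r') t' -> p = r /\ p' = r'.
Proof.
move=> h; case: h r r' => {}q.
1-3: by move=> r r' h; inversion h.
all: move=> i r r' h; inversion h as [| | |q' j|q' j]; subst => t0 t0' e; split=> //.
all: congr Dia; apply: frac_inj; move: e; rewrite /lerp /coord; move: (frac i) (frac j) => s s'.
all: case: q {h} => /= -[e1 e2]; have tt : t = t' by lra.
all: by subst t'; apply: (Rmult_eq_reg_l t); lra.
Qed.

Lemma region_disj c q c' q' x : region c q x -> region c' q' x -> c = c' /\ q = q'.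
Proof.
case: x => x y; case: c; case: c' => //; case: q; case: q' => //; rewrite /region /=; lra.
Qed.

Lemma region_vertex c q p : ~ region c q (coord p).
Proof.
case: p => [o|o|o i].
1-2: by case: c; case: q; case: o; rewrite /region /=; lra.
have := frac01 i; case: c; case: q; case: o; rewrite /region /=; lra.
Qed.

Lemma coord_inj : injective coord.
Proof.
case=> [o|o|o i] [o'|o'|o' j].
all: try (have := frac01 i); try (have := frac01 j).
1-8: by case: o; case: o' => //= *; exfalso; repeat match goal with H : (_, _) = (_, _) |- _ => injection H; clear H; intros end; lra.
move=> s1 s2 e.
have [ea ef] : o = o' /\ frac i = frac j.
  by move: e; case: o; case: o' => /= -[e1 e2]; (split=> //; lra) || (exfalso; lra).
by rewrite ea (frac_inj ef).
Qed.

Lemma segs_cross p p' r r' c q d o t t' :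
  seg p p' c q \/ seg p' p c q -> seg r r' d o \/ seg r' r d o ->
  0 < t < 1 -> 0 < t' < 1 ->
  lerp (coord p) (coord p') t = lerp (coord r) (coord r') t' ->
  (p = r /\ p' = r') \/ (p = r' /\ p' = r).
Proof.
have flip a b u : lerp a b u = lerp b a (1 - u) by rewrite /lerp; congr pair; ring.
have key p0 p0' r0 r0' u u' : seg p0 p0' c q -> seg r0 r0' d o -> 0 < u < 1 -> 0 < u' < 1 ->
    lerp (coord p0) (coord p0') u = lerp (coord r0) (coord r0') u' -> p0 = r0 /\ p0' = r0'.
  move=> s1 s2 u1 u2 e; have r1 := seg_region s1 u1; have r2 := seg_region s2 u2.
  rewrite e in r1; have [h1 h2] := region_disj r1 r2; subst d o.
  by apply: (seg_inj s1 s2 _ _ e); lra.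
have t1' u : 0 < u < 1 -> 0 < 1 - u < 1 by lra.
move=> [s1|s1] [s2|s2] t1 t2 e.
- by left; apply: (key _ _ _ _ t t').
- rewrite [RHS]flip in e.
  by have [-> ->] := key _ _ _ _ _ _ s1 s2 t1 (t1' _ t2) e; right.
- rewrite [LHS]flip in e.
  by have [-> ->] := key _ _ _ _ _ _ s1 s2 (t1' _ t1) t2 e; right.
rewrite [LHS]flip [RHS]flip in e.
by have [-> ->] := key _ _ _ _ _ _ s1 s2 (t1' _ t1) (t1' _ t2) e; left.
Qed.

(* Position of the vertex [(l, b)] of the cube; the antipode of [(l, false)] is
   the non-neighbour [(l, true)]. *)
Definition core (l : nat) (b : bool) : place :=
  match l, b with
  | 0, false => Out Q0 | 1, false => Inn Q3 | 2, false => Inn Q1 | _, false => Out Q2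
  | 0, true => Inn Q2 | 1, true => Out Q1 | 2, true => Out Q3 | _, true => Inn Q0
  end%N.

Definition place_of (k i : nat) (b : bool) : place :=
  if (i %/ 4 == k)%N then core (i %% 4) b
  else Dia (if b then if (i %% 4 < 2)%N then Q0 else Q2
            else if odd (i %% 4) then Q1 else Q3) i.

(** Here [i] has colour [false] and [j] colour [true]. In the block of [i], the corners joined to
    [j] are the even ones if [j %% 4 < 2] and the odd ones otherwise; in the block of [j], the
    corners joined to [i] are exactly those failing this test. *)
Definition block (i j : nat) : nat :=
  if (i %/ 4 == j %/ 4)%N then i %/ 4
  else if ~~ odd (i %% 4) == (j %% 4 < 2)%N then i %/ 4 else j %/ 4.

Lemma place_of_inj k i j b c : place_of k i b = place_of k j c -> i = j /\ b = c.
Proof.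
rewrite /place_of; case: eqP => [ik|_]; case: eqP => [jk|_] //; last first.
- by case=> h ->; split=> //; move: h; case: b; case: c => //; case: ifP => _; case: ifP.
- by case: (j %% 4)%N => [|[|[|l]]]; case: c.
- by case: (i %% 4)%N => [|[|[|l]]]; case: b.
move=> h; have [il jl] : (i %% 4 < 4)%N /\ (j %% 4 < 4)%N by rewrite !ltn_mod.
have [hl ->] : (i %% 4 = j %% 4)%N /\ b = c.
  move: h il jl; case: (i %% 4)%N => [|[|[|[|l]]]]; case: (j %% 4)%N => [|[|[|[|l']]]]; case: b; case: c => //.
by split=> //; rewrite (divn_eq i 4) (divn_eq j 4) ik jk hl.
Qed.

Lemma block_seg i j : i <> j -> exists c q,
  let k := block i j in
  seg (place_of k i false) (place_of k j true) c q \/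
  seg (place_of k j true) (place_of k i false) c q.
Proof.
move=> ij; have [il jl] : (i %% 4 < 4)%N /\ (j %% 4 < 4)%N by rewrite !ltn_mod.
have nl : (i %/ 4 = j %/ 4 -> i %% 4 <> j %% 4)%N.
  by move=> h1 h2; apply: ij; rewrite (divn_eq i 4) (divn_eq j 4) h1 h2.
rewrite /block /place_of; have [e|ne] := eqVneq (i %/ 4)%N (j %/ 4)%N.
  rewrite /= eqxx e eqxx; have {}nl := nl e; move: il jl nl.
  case: (i %% 4)%N => [|[|[|[|l]]]]; case: (j %% 4)%N => [|[|[|[|l']]]] //= _ _ _.
  - by exists Outer, Q0; left; exact: (SegOuter Q0).
  - by exists Outer, Q3; right; exact: (SegOuter Q3).
  - by exists Spoke, Q0; left; exact: (SegSpoke Q0).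
  - by exists Inner, Q2; right; exact: (SegInner Q2).
  - by exists Spoke, Q3; right; exact: (SegSpoke Q3).
  - by exists Inner, Q3; left; exact: (SegInner Q3).
  - by exists Inner, Q1; left; exact: (SegInner Q1).
  - by exists Spoke, Q1; right; exact: (SegSpoke Q1).
  - by exists Inner, Q0; right; exact: (SegInner Q0).
  - by exists Spoke, Q2; left; exact: (SegSpoke Q2).
  - by exists Outer, Q1; right; exact: (SegOuter Q1).
  by exists Outer, Q2; left; exact: (SegOuter Q2).
case h: (~~ odd (i %% 4) == (j %% 4 < 2)%N); cbv beta iota zeta; rewrite eqxx.
  rewrite eq_sym (negbTE ne); move: h {nl}.
  have : (i %% 4 < 4)%N by rewrite ltn_mod.
  case: (i %% 4)%N => [|[|[|[|l]]]] //= _ /eqP <-.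
  - by exists FanO, Q0; left; constructor.
  - by exists FanI, Q2; left; exact: (SegFanI Q2).
  - by exists FanI, Q0; left; exact: (SegFanI Q0).
  by exists FanO, Q2; left; constructor.
rewrite (negbTE ne); move: h {nl}.
have : (j %% 4 < 4)%N by rewrite ltn_mod.
case: (j %% 4)%N => [|[|[|[|l]]]] //= _; case: (odd _) => //= _.
- by exists FanI, Q1; right; exact: (SegFanI Q1).
- by exists FanO, Q1; right; constructor.
- by exists FanO, Q3; right; constructor.
by exists FanI, Q3; right; exact: (SegFanI Q3).
Qed.

(** * The layers and the upper bound *)

Section Upper.
Variables (T : finType) (e : rel T).
Hypothesis eirr : irreflexive e.

(** The conditionals put the end of colour [false] first, so that both orientations of an edge go to
    the same layer. *)
Definition layer (k : nat) : rel (T * bool) := fun p q =>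
  kron e K2 p q &&
  (block (enum_rank (if p.2 then q.1 else p.1)) (enum_rank (if p.2 then p.1 else q.1)) == k).

Let at_ k (p : T * bool) : pt := coord (place_of k (enum_rank p.1) p.2).

Lemma layer_seg k p q : layer k p q -> exists c o,
  seg (place_of k (enum_rank p.1) p.2) (place_of k (enum_rank q.1) q.2) c o \/
  seg (place_of k (enum_rank q.1) q.2) (place_of k (enum_rank p.1) p.2) c o.
Proof.
case: p => x b; case: q => y d; rewrite /layer /kron /K2 /= => /andP[/andP[exy bd] /eqP bl].
have xy : x <> y by move=> h; rewrite h eirr in exy.
have ne (u v : T) : u <> v -> nat_of_ord (enum_rank u) <> enum_rank v.
  by move=> uv h; apply: uv; apply: enum_rank_inj; apply: val_inj.
case: b d bd bl => -[] //= _ <-.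
  by have [c [o [h|h]]] := block_seg (ne _ _ (nesym xy)); exists c, o; [right|left].
by have [c [o [h|h]]] := block_seg (ne _ _ xy); exists c, o; [left|right].
Qed.

Lemma layer_planar k : planar (layer k).
Proof.
have inj p q : at_ k p = at_ k q -> p = q.
  case: p => x b; case: q => y d /coord_inj/place_of_inj[/val_inj/enum_rank_inj].
  by move=> /= -> ->.
exists (fun p => (at_ k p).1), (fun p => (at_ k p).2).
exists (fun p q t => (lerp (at_ k p) (at_ k q) t).1), (fun p q t => (lerp (at_ k p) (at_ k q) t).2).
have pairE (x y : pt) : x.1 = y.1 -> x.2 = y.2 -> x = y by case: x; case: y => ? ? ? ? /= -> ->.
split; [by move=> p q h1 h2; apply: inj; apply: pairE|split].
  move=> p q pq; have [c [o sg]] := layer_seg pq.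
  split; [by rewrite /lerp /=; reg|split; [by rewrite /lerp /=; reg|]].
  do 4 (split; [by rewrite /lerp /=; ring|]).
  split.
    move=> s t s01 t01; rewrite /lerp /= => h1 h2.
    apply: NNPP => st.
    have same a b : a + s * (b - a) = a + t * (b - a) -> a = b.
      by move=> h; apply: NNPP => ab; apply: st; apply: (Rmult_eq_reg_r (b - a)); lra.
    have pq' := pairE _ _ (same _ _ h1) (same _ _ h2).
    have h := inj _ _ pq'; move: pq; rewrite h /layer /kron eirr //.
  move=> t w t01 [h1 h2]; have ht := pairE _ _ h1 h2.
  case: sg => sg.
    by have := seg_region sg t01; rewrite -/(at_ k p) -/(at_ k q) ht; apply: region_vertex.
  have t01' : 0 < 1 - t < 1 by lra.
  have := seg_region sg t01'; rewrite -/(at_ k p) -/(at_ k q).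
  have -> : lerp (at_ k q) (at_ k p) (1 - t) = lerp (at_ k p) (at_ k q) t by rewrite /lerp; congr pair; ring.
  by rewrite ht; apply: region_vertex.
move=> p q p' q' pq pq' ne s t s01 t01 [h1 h2]; apply: ne.
have [c [o sg]] := layer_seg pq; have [c' [o' sg']] := layer_seg pq'.
have [[h3 h4]|[h3 h4]] := segs_cross sg sg' s01 t01 (pairE _ _ h1 h2).
  by left; split; apply: inj; rewrite /at_ ?h3 ?h4.
by right; split; apply: inj; rewrite /at_ ?h3 ?h4.
Qed.

Lemma layers_decomposition :
  planar_decomposition (kron e K2) (fun k : 'I_((#|T| + 3) %/ 4) => layer k).
Proof.
split; first by move=> k x y /andP[].
split; first by move=> k; apply: layer_planar.
move=> p q pq.
have lt (i j : 'I_#|T|) : (block i j < (#|T| + 3) %/ 4)%N.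
  have lt4 (u : 'I_#|T|) : (u %/ 4 < (#|T| + 3) %/ 4)%N.
    by have := ltn_ord u; lia.
  by rewrite /block; case: ifP => // _; case: ifP.
exists (Ordinal (lt (enum_rank (if p.2 then q.1 else p.1)) (enum_rank (if p.2 then p.1 else q.1)))).
by rewrite /layer pq /=.
Qed.

End Upper.

(** * Counting edges over the layers, and conclusion *)

Lemma decomposition_lower (T : finType) (e : rel T) k (H : 'I_k -> rel (T * bool)) :
  (2 <= #|T|)%N -> planar_decomposition (kron e K2) H ->
  (#|[set p : T * T | e p.1 p.2]| <= k * (4 * #|T| - 4))%N.
Proof.
move=> T2 [_ [pl cov]].
(* Edges of the product, read from colour [false] to [true], are the ordered adjacent pairs of the
   graph, twice as many as its edges. *)
pose F i := [set p : T * T | H i (p.1, false) (p.2, true)].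
apply: (@leq_trans (\sum_(i < k) #|F i|)%N).
  apply: (@leq_trans #|\bigcup_(i < k) F i|).
    apply: subset_leq_card; apply/subsetP => -[x y]; rewrite inE /= => exy.
    have [|i hi] := cov (x, false) (y, true); first by rewrite /kron /= exy.
    by apply/bigcupP; exists i => //; rewrite inE.
  elim/big_rec2: _ => [|i m A _ IH]; first by rewrite cards0.
  by apply: leq_trans (leq_card_setU _ _) _; rewrite leq_add2l.
rewrite -[k in (k * _)%N]card_ord -sum_nat_const; apply: leq_sum => i _.
by have := planar_bipartite_bound (pl i) T2; rewrite -/(F i); lia.
Qed.

Lemma nat_least (P : nat -> Prop) n : P n ->
  exists m, [/\ P m, (m <= n)%N & forall k, P k -> (m <= k)%N].
Proof.
elim/ltn_ind: n => n IH Pn.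
case: (classic (exists2 k, P k & (k < n)%N)) => [[k Pk kn]|none].
  by have [m [Pm mk min]] := IH k kn Pk; exists m; split=> //; lia.
exists n; split=> // k Pk; rewrite leqNgt; apply/negP => kn; apply: none; by exists k.
Qed.

Local Close Scope R_scope.

Theorem theorem3p4 (T : finType) (e : rel T)
    (esym : symmetric e) (eirr : irreflexive e) (hn : 2 <= #|T|) :
  exists t, thickness (kron e K2) t /\
    (nedges e + (2 * #|T| - 2) - 1) %/ (2 * #|T| - 2) <= t /\
    t <= (#|T| + 3) %/ 4.
Proof.
have [t [[H dH] tle min]] := @nat_least
  (fun k => exists H : 'I_k -> rel (T * bool), planar_decomposition (kron e K2) H) ((#|T| + 3) %/ 4)
  (ex_intro _ _ (layers_decomposition eirr)).
exists t; split; first by split=> [|k H' dH']; [exists H|apply: min; exists H'].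
split=> //; have := decomposition_lower hn dH.
rewrite /nedges; set m := #|_| => hm.
(* The quotient is a ceiling, bounded by [t] as soon as the numerator is below [t.+1] times the
   divisor; halving [m] halves the bound 4 n - 4 for each layer. *)
rewrite -ltnS ltn_divLR; last by lia.
have : (m %/ 2 <= t * (2 * #|T| - 2))%N by lia.
by rewrite mulSn; lia.
Qed.
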